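(* Let $X$ and $Y$ be two function spaces on $\mathbb{R}^d$ with continuous embedding $X\subset Y$ and with the same scaling: for some $r\in\mathbb{R}$, $\|f(h\,\cdot)\|_X=h^{-r}\|f\|_X$ and $\|f(h\,\cdot)\|_Y=h^{-r}\|f\|_Y$ for every $f$ and every $h>0$. Assume that there exists a wavelet basis $(\psi_\lambda)_{\lambda\in\nabla}$, $\nabla=\mathbb{Z}\times\mathbb{Z}^d$, which is an unconditional basis for both $X$ and $Y$ and for which Assumptions 1 and 2 (both stated in the context) hold. Let $(u_n)_{n>0}$ be a bounded sequence in $X$. Then, up to extraction of a subsequence (still denoted $(u_n)_{n>0}$), there exist a family of functions $(\phi^l)_{l>0}$ in $X$ and, for each $l>0$, a sequence of scale-space indices $(\lambda_l(n))_{n>0}$ in $\nabla$ such that, writing for every $L>0$ $$u_n=\sum_{l=1}^L \phi^l_{\lambda_l(n)}+r_{n,L},$$ one has $$\lim_{L\to+\infty}\Bigl(\limsup_{n\to+\infty}\|r_{n,L}\|_Y\Bigr)=0.$$ Moreover, the decomposition is asymptotically orthogonal in the sense that for any $k\neq l$, as $n\to+\infty$, $$|j(\lambda_k(n))-j(\lambda_l(n))|\to+\infty\quad\text{or}\quad \bigl|k(\lambda_k(n))-2^{j(\lambda_k(n))-j(\lambda_l(n))}k(\lambda_l(n))\bigr|\to+\infty.$$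
   Context: **Spaces.** $X$ and $Y$ are homogeneous function spaces on $\mathbb{R}^d$, whose norms are translation invariant in addition to satisfying the scaling identity in the claim. **Indices and rescaling.** $\nabla:=\mathbb{Z}\times\mathbb{Z}^d$. For $\lambda=(j,k)\in\nabla$, write $j(\lambda)=j$ (scale index) and $k(\lambda)=k$ (space index). For any function $\phi$ and $\lambda=(j,k)$, set $\phi_\lambda:=2^{rj}\phi(2^j\cdot-k)$, with $r$ the scaling exponent of $X$ and $Y$. **Wavelets.** Wavelet decompositions have the form $f=\sum_{\lambda\in\nabla}d_\lambda\psi_\lambda$ with $\psi_\lambda=2^{rj}\psi(2^j\cdot-k)$ for $\lambda=(j,k)$. With this normalization $\|\psi_\lambda\|_X$ and $\|\psi_\lambda\|_Y$ do not depend on $\lambda$. For $d=1$, $\psi$ is a single function (the mother wavelet). For $d>1$, there are finitely many generating functions $\psi^e$, $e\in E$ ($E$ a finite set), and $\psi=(\psi^e)_{e\in E}$, $\psi_\lambda=(\psi^e_\lambda)_{e\in E}$, $d_\lambda=(d^e_\lambda)_{e\in E}$ are vectors, $d_\lambda\psi_\lambda$ is their finite-dimensional inner product, and $|d_\lambda|$ is the modulus of the vector $d_\lambda$. **Unconditional basis.** $(\psi_\lambda)_{\lambda\in\nabla}$ is an unconditional basis for a space $Z$ (here $Z=X$ and $Z=Y$) if it is a Schauder basis of $Z$ and there is a constant $D$ such that for every finite $F\subset\nabla$ and all coefficients with $|c_\lambda|\le|d_\lambda|$ for all $\lambda\in F$, $$\Bigl\|\sum_{\lambda\in F}c_\lambda\psi_\lambda\Bigr\|_Z\le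 D\Bigl\|\sum_{\lambda\in F}d_\lambda\psi_\lambda\Bigr\|_Z .$$ **Nonlinear projector.** For $M>0$ and $f=\sum_{\lambda\in\nabla}d_\lambda\psi_\lambda\in X$, let $Q_Mf:=\sum_{\lambda\in E_M}d_\lambda\psi_\lambda$, where $E_M=E_M(f)\subset\nabla$ has cardinality $M$ and corresponds to the $M$ largest values of $|d_\lambda|$ (an arbitrary choice is made in case of ties). **Assumption 1.** $\displaystyle\lim_{M\to+\infty}\max_{\|f\|_X\le1}\|f-Q_Mf\|_Y=0$ (the max is understood as a supremum). **Assumption 2.** There is a constant $C$, depending only on $X$ and on the wavelet basis, such that the following holds. Let $(f_n)_{n>0}$ be uniformly bounded in $X$ with $f_n=\sum_{\lambda\in\nabla}c_{\lambda,n}\psi_\lambda$, and suppose that for every $\lambda$ the sequence $c_{\lambda,n}$ converges to a finite limit $c_\lambda$ as $n\to+\infty$. Then the series $\sum_{\lambda\in\nabla}c_\lambda\psi_\lambda$ converges in $X$ and $$\Bigl\|\sum_{\lambda\in\nabla}c_\lambda\psi_\lambda\Bigr\|_X\le C\liminf_{n\to+\infty}\|f_n\|_X .$$ *)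

(* Defs.v *)
From HB Require Import structures.
From mathcomp Require Import all_boot all_order all_algebra finmap.
From mathcomp Require Import all_classical all_reals all_analysis.
From mathcomp Require Import complex.
Set Implicit Arguments.
Unset Strict Implicit.
Unset Printing Implicit Defensive.
Import Order.TTheory GRing.Theory Num.Theory.
Import numFieldNormedType.Exports.
Local Open Scope classical_set_scope.
Local Open Scope ring_scope.

(* The scalar field is R when [cplx] is false and R[i] when it is true, so that
   real-valued and complex-valued function spaces are covered at once. *)
Definition scalar (R : realType) (cplx : bool) : numFieldType :=
  if cplx then (R[i] : numFieldType) else (R : numFieldType).

Definition of_real {R : realType} {cplx : bool} : R -> scalar R cplx :=
  if cplx return R -> scalar R cplx then fun x => (x%:C)%C else fun x => x.

Definition modulus {R : realType} {cplx : bool} : scalar R cplx -> R :=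
  if cplx return scalar R cplx -> R then fun z => Normc.normc z
  else fun x : R => `|x|.

Definition func (R : realType) (cplx : bool) (d : nat) : Type :=
  'rV[R]_d -> scalar R cplx.

(* A linear space of functions on R^d together with its norm. The norm is not
   required to be definite on pointwise-defined functions: as usual, two
   functions at distance 0 (for instance equal almost everywhere in L^p, or
   differing by a constant in BMO) represent the same element of the space. The
   values of [fnorm] outside the space are irrelevant. *)
Record functionSpace (R : realType) (cplx : bool) (d : nat) := FunctionSpace {
  in_space :> func R cplx d -> Prop;
  fnorm : func R cplx d -> R;
  in_space0 : in_space (fun=> 0);
  in_spaceD : forall f g, in_space f -> in_space g ->
    in_space (fun x => f x + g x);
  in_spaceZ : forall (a : scalar R cplx) f, in_space f ->
    in_space (fun x => a * f x);
  fnormD : forall f g, in_space f -> in_space g ->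
    fnorm (fun x => f x + g x) <= fnorm f + fnorm g;
  fnormZ : forall (a : scalar R cplx) f, in_space f ->
    fnorm (fun x => a * f x) = modulus a * fnorm f
}.

Section SpaceProperties.
Variables (R : realType) (cplx : bool) (d : nat).
Implicit Types X Y : functionSpace R cplx d.

Definition continuous_embedding X Y :=
  (forall f, X f -> Y f) /\
  exists C : R, forall f, X f -> fnorm Y f <= C * fnorm X f.

Definition translation_invariant X :=
  forall (a : 'rV[R]_d) f, X f ->
    X (fun x => f (x - a)) /\ fnorm X (fun x => f (x - a)) = fnorm X f.

Definition scaling_invariant (r : R) X :=
  forall (h : R) f, 0 < h -> X f ->
    X (fun x => f (h *: x)) /\
    fnorm X (fun x => f (h *: x)) = h `^ (- r) * fnorm X f.

Definition bounded_seq_in X (u : nat -> func R cplx d) :=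
  (forall n, X (u n)) /\ exists B : R, forall n, fnorm X (u n) <= B.

End SpaceProperties.

Definition nabla (d : nat) := (int * 'rV[int]_d)%type.

Definition scale_index (d : nat) (l : nabla d) : int := l.1.

Definition space_index (R : realType) (d : nat) (l : nabla d) : 'rV[R]_d :=
  map_mx intr l.2.

Definition enorm (R : realType) (d : nat) (v : 'rV[R]_d) : R :=
  Num.sqrt (\sum_(i < d) v 0 i ^+ 2).

Definition rescaled (R : realType) (cplx : bool) (d : nat) (r : R)
    (phi : func R cplx d) (l : nabla d) : func R cplx d :=
  fun x => of_real (2 `^ (r * (scale_index l)%:~R)) *
           phi ((2 : R) ^ scale_index l *: x - space_index R l).

Section Wavelets.
Variables (R : realType) (cplx : bool) (d : nat) (r : R).
Variables (E : finType) (psi : E -> func R cplx d).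
Implicit Types (X Y Z : functionSpace R cplx d) (f : func R cplx d).

Definition coefs : Type := nabla d -> E -> scalar R cplx.

Definition coef_norm (v : E -> scalar R cplx) : R :=
  Num.sqrt (\sum_(e : E) modulus (v e) ^+ 2).

Definition wavelet_sum (c : coefs) (F : {fset nabla d}) : func R cplx d :=
  fun x => \sum_(l <- F) \sum_(e : E) c l e * rescaled r (psi e) l x.

(* [f] is the sum in [Z] of the series with coefficients [c]: the index set
   nabla carries no order, so the partial sums are taken along the directed set
   of its finite subsets. *)
Definition wavelet_series Z (c : coefs) f :=
  Z f /\ forall eps : R, 0 < eps -> exists F0 : {fset nabla d},
    forall F : {fset nabla d}, (F0 `<=` F)%fset ->
      fnorm Z (fun x => f x - wavelet_sum c F x) < eps.

Definition unconditional_basis Z :=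
  [/\ forall l e, Z (rescaled r (psi e) l),
      forall f, Z f -> exists! c : coefs, wavelet_series Z c f &
      exists D : R, forall (F : {fset nabla d}) (c c' : coefs),
        (forall l, l \in F -> coef_norm (c l) <= coef_norm (c' l)) ->
        fnorm Z (wavelet_sum c F) <= D * fnorm Z (wavelet_sum c' F)].

Definition wavelet_coefs X f : coefs :=
  xget (fun _ _ => 0) [set c | wavelet_series X c f].

(* [sel M f] plays the role of the index set E_M(f); quantifying over [sel]
   amounts to leaving the choice in case of ties arbitrary. *)
Definition selects_largest X (sel : nat -> func R cplx d -> {fset nabla d}) :=
  forall (M : nat) f, (0 < M)%N -> X f ->
    #|` sel M f| = M /\
    forall l l', l \in sel M f -> l' \notin sel M f ->
      coef_norm (wavelet_coefs X f l') <= coef_norm (wavelet_coefs X f l).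

Definition nonlinear_projector X
    (sel : nat -> func R cplx d -> {fset nabla d}) (M : nat) f :
    func R cplx d :=
  wavelet_sum (wavelet_coefs X f) (sel M f).

Definition uniform_nonlinear_approximation X Y
    (sel : nat -> func R cplx d -> {fset nabla d}) :=
  (fun M : nat => ereal_sup
     [set (fnorm Y (fun x => f x - nonlinear_projector X sel M f x))%:E
     | f in [set f | X f /\ fnorm X f <= 1]]) @ \oo --> 0%E.

Definition coefficientwise_limit_bound X :=
  exists C : R, forall (f : nat -> func R cplx d) (c : nat -> coefs)
      (c0 : coefs),
    bounded_seq_in X f ->
    (forall n, wavelet_series X (c n) (f n)) ->
    (forall l e, (fun n => modulus (c n l e - c0 l e)) @ \oo --> (0 : R)) ->
    exists2 g, wavelet_series X c0 g &
      ((fnorm X g)%:E <= C%:E * limn_einf (fun n => (fnorm X (f n))%:E))%E.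

End Wavelets.

(* Main.v *)
Require Import Defs.
From mathcomp Require Import all_boot all_order all_algebra finmap.
From mathcomp Require Import all_classical all_reals all_analysis.
From mathcomp Require Import complex zify ring lra.
Set Implicit Arguments.
Unset Strict Implicit.
Unset Printing Implicit Defensive.
Import Order.TTheory GRing.Theory Num.Theory.
Import numFieldNormedType.Exports.
Local Open Scope classical_set_scope.
Local Open Scope ring_scope.

(** Let [c n] be the wavelet coefficients of [u n]. By nonlinear approximation,
finitely many wavelets of [u n], their number depending only on the accuracy,
give [u n] up to a small error in Y, uniformly in n. They are listed as
[en n 0, en n 1, ...] without repetition ([enumerate_fsets]), and the proof
follows, for each rank m, the wavelet [en n m] and its coefficient as n varies.

A nonprincipal ultrafilter on nat decides all the alternatives left open by
n -> oo: the coefficient of rank m, bounded by unconditionality, has a limit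
[a m]; and for two ranks, either the relative position of the two wavelets is
constant, or the difference of scales or the displacement diverges, because at a
fixed difference of scales the displacements lie in a lattice
([relpos_dichotomy]). Only countably many events are at stake, so they all hold
eventually along one subsequence ([extraction]). Having a constant relative
position is an equivalence relation on ranks. Each class gives one profile, placed
at the wavelet whose rank l is the least of the class: the profile is the sum
over the class of the limit coefficients times the generators moved to their
relative positions.

This sum may involve wavelets at non-integer positions, when its scales are
unbounded below, so that its convergence is not that of a series in the basis.
However, its partial sums, carried to [en n l], are sub-sums of the expansion of
[u n] up to o(1). By unconditionality they are bounded in X and, by nonlinear
approximation, Cauchy in Y. A sequence bounded in X and Cauchy in Y has a limit
in X for the norm of Y ([cauchy_limit_in_X]): its coefficients converge, the
coefficientwise limit is in X by hypothesis, and finite projections, bounded in Y,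
turn the coefficientwise convergence into convergence in Y.

After L profiles, the remainder consists, up to errors that vanish as n and then
the truncation rank grow, of terms whose class starts at a rank at least L, hence
of terms of rank at least L. These are small in Y uniformly in n
([profile_remainder]).

All these estimates are instances of one inequality ([basis_comparison]): if the
coefficients of a series are dominated by those of another one, so is its norm, up
to a constant. *)

(** * Scalars *)

Section Scalars.
Variables (R : realType) (cplx : bool).
Implicit Types z w : Defs.scalar R cplx.

Lemma modulus0 : modulus (0 : Defs.scalar R cplx) = 0.
Proof. by case: cplx => /=; [exact: Normc.normc0 | rewrite normr0]. Qed.

Lemma modulusD z w : modulus (z + w) <= modulus z + modulus w.
Proof. by case: cplx z w => z w; [exact: le_normcD | exact: ler_normD]. Qed.

Lemma modulusN z : modulus (- z) = modulus z.
Proof. by case: cplx z => z; [exact: normcN | exact: normrN]. Qed.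

Lemma modulus_ge0 z : 0 <= modulus z.
Proof.
by case: cplx z => z /=; [case: z => a b; exact: sqrtr_ge0 | exact: normr_ge0].
Qed.

Lemma modulus_real (x : R) : modulus (of_real x : Defs.scalar R cplx) = `|x|.
Proof. by case: cplx => //=; rewrite expr0n addr0 sqrtr_sqr. Qed.

Lemma of_realM (x y : R) :
  of_real (x * y) = of_real x * of_real y :> Defs.scalar R cplx.
Proof. by case: cplx => //=; exact: rmorphM. Qed.

Lemma of_real1 : of_real 1 = 1 :> Defs.scalar R cplx.
Proof. by case: cplx. Qed.

Lemma modulus1 : modulus (1 : Defs.scalar R cplx) = 1.
Proof. by rewrite -of_real1 modulus_real normr1. Qed.

End Scalars.

(** * Limits along an ultrafilter *)

Section Ultralimits.
Variables (U : set_system nat) (UU : UltraFilter U).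

Lemma ultra_cvg_real (R : realType) (x : nat -> R) (B : R) :
    (forall n, `|x n| <= B) ->
  exists x0, forall eps, 0 < eps -> U [set n | `|x n - x0| < eps].
Proof.
move=> xB.
have xU : (x @ U) [set` `[- B, B]].
  rewrite /= /nbhs /=; apply: (@filterS _ U _ setT) => [n _|]; last exact: filterT.
  by rewrite /= in_itv /= -ler_norml.
have [x0 [_ x0cl]] := @segment_compact R (- B) B _ _ xU.
exists x0 => eps eps0.
have [//|nU] := in_ultra_setVsetC [set n | `|x n - x0| < eps] UU.
have xfar : (x @ U) (~` ball x0 eps).
  by rewrite /= /nbhs /=; apply: filterS nU => n /=; rewrite /ball /= distrC.
by have [y []] := x0cl _ _ xfar (nbhsx_ballx x0 eps eps0).
Qed.

Lemma ultra_cvg_scalar (R : realType) (cplx : bool) (z : nat -> Defs.scalar R cplx)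
    (B : R) : (forall n, modulus (z n) <= B) ->
  exists z0, forall eps, 0 < eps -> U [set n | modulus (z n - z0) < eps].
Proof.
case: cplx z => z zB; last exact: (ultra_cvg_real zB).
have le_sqrt (a b : R) : `|a| <= Num.sqrt (a ^+ 2 + b ^+ 2).
  by rewrite -sqrtr_sqr ler_wsqrtr // lerDl sqr_ge0.
have le_abs_ReIm (w : R[i]) :
    Normc.normc w <= `|complex.Re w| + `|complex.Im w|.
  case: w => a b; have := le_normcD (Complex a 0) (Complex 0 b).
  by rewrite /= expr0n /= !(add0r, addr0) !sqrtr_sqr.
have [|a0 ha] := @ultra_cvg_real R (fun n => complex.Re (z n)) B.
  by move=> n; apply: le_trans (zB n); case: (z n) => a b; exact: le_sqrt.
have [|b0 hb] := @ultra_cvg_real R (fun n => complex.Im (z n)) B.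
  move=> n; apply: le_trans (zB n); case: (z n) => a b /=.
  by rewrite addrC; exact: le_sqrt.
exists (Complex a0 b0) => eps eps0.
have e2 : 0 < eps / 2 by rewrite divr_gt0.
apply: filterS (filterI (ha _ e2) (hb _ e2)) => n /=.
move=> [h1 h2]; apply: le_lt_trans (le_abs_ReIm _) _; move: h1 h2.
by case: (z n) => a b /= h1 h2; rewrite (splitr eps) ltrD.
Qed.

Lemma ultra_finite (T : eqType) (z : nat -> T) (s : seq T) :
  U [set n | z n \in s] -> exists c, U [set n | z n = c].
Proof.
elim: s => [|c s ih] zs; first by have [] := filter_ex zs.
have [zc|zc] := in_ultra_setVsetC [set n | z n = c] UU; first by exists c.
apply: ih; apply: filterS (filterI zs zc) => n [/=].
by rewrite in_cons => /orP[/eqP|].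
Qed.

Lemma ultra_bounded_int (z : nat -> int) (K : int) :
  U [set n | `|z n| <= K] -> exists c, U [set n | z n = c].
Proof.
move=> zK; pose s : seq int := [seq i%:Z - K | i <- iota 0 (2 * `|K|%N).+1].
apply: (@ultra_finite _ _ s); apply: filterS zK => n zn.
have {}zn : `|z n| <= K by [].
suff : z n \in s by [].
by apply/mapP; exists `|(z n + K)%R|%N; [rewrite mem_iota; lia | lia].
Qed.

(** Since an ultrafilter decides every alternative beforehand, one extraction is
enough, without diagonal argument: the k-th term is chosen in the intersection of
the first k events, which is large and hence infinite. *)
Lemma ultra_subsequence (I : countType) (A : I -> set nat) :
    (forall N, U [set n | (N <= n)%N]) -> (forall i, U (A i)) ->
  exists sigma : nat -> nat, (forall m n, (m < n)%N -> (sigma m < sigma n)%N) /\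
    forall i, \forall n \near \oo, A i (sigma n).
Proof.
move=> UN UA.
pose A' k := oapp A setT (choice.unpickle k).
have UA' k : U (A' k).
  by rewrite /A'; case: (choice.unpickle k) => [i|]; [exact: UA | exact: filterT].
pose G k := [set n | forall i, (i <= k)%N -> A' i n].
have UG k : U (G k).
  elim: k => [|k ih].
    by apply: filterS (UA' 0) => n hn i; rewrite leqn0 => /eqP ->.
  apply: filterS (filterI ih (UA' k.+1)) => n [h1 h2] i.
  by rewrite leq_eqVlt => /orP[/eqP -> //|]; exact: h1.
have pick k m : {n | (m < n)%N /\ G k n}.
  by apply: cid; have [n [h1 h2]] := filter_ex (filterI (UN m.+1) (UG k)); exists n.
pose sigma := fix s k := if k is k'.+1 then sval (pick k (s k')) else sval (pick 0 0).
have sG k : G k (sigma k).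
  by case: k => [|k] /=; [case: (svalP (pick 0 0)) | case: (svalP (pick k.+1 (sigma k)))].
exists sigma; split.
  move=> m n; elim: n => // n ih; rewrite ltnS leq_eqVlt.
  have sn : (sigma n < sigma n.+1)%N by case: (svalP (pick n.+1 (sigma n))).
  by move=> /orP[/eqP -> //|/ih /ltn_trans]; apply.
move=> i; exists (choice.pickle i) => // n /= hn.
by have := sG n _ hn; rewrite /A' choice.pickleK.
Qed.

End Ultralimits.

Lemma ultrafilter_oo : exists2 U : set_system nat, UltraFilter U &
  forall A : set nat, (\forall n \near \oo, A n) -> U A.
Proof. by have [U [UU sU]] := ultraFilterLemma eventually_filter; exists U. Qed.

Lemma scalar_complete (R : realType) (cplx : bool) (z : nat -> Defs.scalar R cplx) :
    (forall eps : R, 0 < eps -> exists N0 : nat, forall N N',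
       (N0 <= N)%N -> (N <= N')%N -> modulus (z N - z N') <= eps) ->
  exists z0, (fun N => modulus (z N - z0)) @ \oo --> (0 : R).
Proof.
move=> zC; have [U UU Uoo] := ultrafilter_oo.
have [N1 hN1] := zC 1 ltr01.
have [n|z0 hz0] := @ultra_cvg_scalar U UU R cplx (fun n => z (N1 + n)%N)
  (1 + modulus (z N1)).
  have -> : z (N1 + n)%N = - (z N1 - z (N1 + n)%N) + z N1 by rewrite opprB subrK.
  apply: le_trans (modulusD _ _) _; rewrite modulusN lerD2r.
  by apply: hN1; rewrite ?leq_addr.
exists z0; apply/cvgr0Pnorm_le => eps eps0.
have e2 : 0 < eps / 2 by rewrite divr_gt0.
have [N0 hN0] := zC _ e2.
exists N0 => // N /= N0N; rewrite ger0_norm ?modulus_ge0 //.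
have UN : U [set n | (N <= n)%N] by apply: Uoo; exists N.
have [n [/= nz Nn]] := filter_ex (filterI (hz0 _ e2) UN).
have h := hN0 N (N1 + n)%N N0N (leq_trans Nn (leq_addl _ _)).
have -> : z N - z0 = (z N - z (N1 + n)%N) + (z (N1 + n)%N - z0) by rewrite addrA subrK.
by apply: le_trans (modulusD _ _) _; rewrite (splitr eps) lerD // ltW.
Qed.

Lemma cvg_sum0 (R : realType) (I : Type) (s : seq I) (P : pred I)
    (x : I -> nat -> R) : (forall i, P i -> x i @ \oo --> (0 : R)) ->
  (fun n => \sum_(i <- s | P i) x i n) @ \oo --> (0 : R).
Proof.
move=> x0; elim: s => [|i s ih].
  by under eq_fun do rewrite big_nil; exact: cvg_cst.
case Pi: (P i); last by under eq_fun do rewrite big_cons Pi.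
under eq_fun do rewrite big_cons Pi.
by have := cvgD (x0 i Pi) ih; rewrite addr0; exact.
Qed.

(** * Semi-normed function spaces *)

Section FunctionSpaceNorm.
Variables (R : realType) (cplx : bool) (d : nat) (Z : functionSpace R cplx d).
Implicit Types f g h : func R cplx d.

Lemma in_spaceN f : Z f -> Z (fun x => - f x).
Proof.
move=> Zf; have -> : (fun x => - f x) = (fun x => - 1 * f x).
  by apply/funext => x; rewrite mulN1r.
exact: in_spaceZ.
Qed.

Lemma in_spaceB f g : Z f -> Z g -> Z (fun x => f x - g x).
Proof. by move=> Zf Zg; apply: in_spaceD => //; exact: in_spaceN. Qed.

Lemma in_space_sum (I : Type) (s : seq I) (P : pred I) (F : I -> func R cplx d) :
  (forall i, P i -> Z (F i)) -> Z (fun x => \sum_(i <- s | P i) F i x).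
Proof.
move=> ZF; elim: s => [|i s ih].
  have -> : (fun x => \sum_(i <- [::] | P i) F i x) = (fun=> 0).
    by apply/funext => x; rewrite big_nil.
  exact: in_space0.
case Pi: (P i); last first.
  by under eq_fun do rewrite big_cons Pi.
by under eq_fun do rewrite big_cons Pi; apply: in_spaceD => //; exact: ZF.
Qed.

Lemma fnorm0 : fnorm Z (fun=> 0) = 0.
Proof.
by have := fnormZ 0 (in_space0 Z); rewrite mul0r modulus0 mul0r.
Qed.

Lemma fnormN f : Z f -> fnorm Z (fun x => - f x) = fnorm Z f.
Proof.
move=> Zf; have -> : (fun x => - f x) = (fun x => - 1 * f x).
  by apply/funext => x; rewrite mulN1r.
by rewrite fnormZ // modulusN modulus1 mul1r.
Qed.

Lemma fnorm_ge0 f : Z f -> 0 <= fnorm Z f.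
Proof.
move=> Zf; have := fnormD Zf (in_spaceN Zf); rewrite fnormN //.
under eq_fun do rewrite subrr.
by rewrite fnorm0 -mulr2n pmulrn_lge0.
Qed.

Lemma fnormBC f g : Z f -> Z g ->
  fnorm Z (fun x => f x - g x) = fnorm Z (fun x => g x - f x).
Proof.
move=> Zf Zg; rewrite -fnormN; last exact: in_spaceB.
by congr fnorm; apply/funext => x; rewrite opprB.
Qed.

Lemma fnorm_split f g : Z f -> Z g ->
  fnorm Z f <= fnorm Z (fun x => f x - g x) + fnorm Z g.
Proof.
move=> Zf Zg; have := fnormD (in_spaceB Zf Zg) Zg.
by under eq_fun do rewrite subrK.
Qed.

Lemma fnorm_distD g f h : Z f -> Z g -> Z h ->
  fnorm Z (fun x => f x - h x) <=
  fnorm Z (fun x => f x - g x) + fnorm Z (fun x => g x - h x).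
Proof.
move=> Zf Zg Zh; have := fnormD (in_spaceB Zf Zg) (in_spaceB Zg Zh).
by under eq_fun do rewrite addrA subrK.
Qed.

Lemma fnorm_sum (I : Type) (s : seq I) (P : pred I) (F : I -> func R cplx d) :
  (forall i, P i -> Z (F i)) ->
  fnorm Z (fun x => \sum_(i <- s | P i) F i x) <=
  \sum_(i <- s | P i) fnorm Z (F i).
Proof.
move=> ZF; elim: s => [|i s ih].
  by under eq_fun do rewrite big_nil; rewrite big_nil fnorm0.
rewrite big_cons; case Pi: (P i); last first.
  by under eq_fun do rewrite big_cons Pi.
under eq_fun do rewrite big_cons Pi.
apply: le_trans (fnormD _ _) _; [exact: ZF | exact: in_space_sum |].
by rewrite lerD2l.
Qed.

End FunctionSpaceNorm.

(** * Translations and dyadic dilations *)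

(** The action of the affine group underlying [rescaled], with translations by
arbitrary vectors: the position of a wavelet relative to a coarser one is in
general not an integer vector. *)
Definition dilate (R : realType) (cplx : bool) (d : nat) (r : R) (j : int)
    (a : 'rV[R]_d) (f : func R cplx d) : func R cplx d :=
  fun x => of_real (2 `^ (r * j%:~R)) * f ((2 : R) ^ j *: x - a).

Section Dilations.
Variables (R : realType) (cplx : bool) (d : nat) (r : R).
Implicit Types (f : func R cplx d) (Z : functionSpace R cplx d).

Lemma rescaledE f (l : nabla d) :
  rescaled r f l = dilate r (scale_index l) (space_index R l) f.
Proof. by []. Qed.

Lemma dilate_comp (i j : int) (a b : 'rV[R]_d) f :
  dilate r i a (dilate r j b f) = dilate r (i + j) ((2 : R) ^ j *: a + b) f.
Proof.
apply/funext => x; rewrite /dilate mulrA -of_realM -powRD; last first.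
  by rewrite pnatr_eq0 implybT.
rewrite -mulrDr -intrD; congr (_ * f _).
by rewrite scalerBr scalerA -expfzDr ?pnatr_eq0 // opprD addrA [j + i]addrC.
Qed.

Lemma dilate_id f : dilate r 0 0 f = f.
Proof.
apply/funext => x.
by rewrite /dilate mulr0 powRr0 of_real1 mul1r expr0z scale1r subr0.
Qed.

Lemma dilate_norm Z (transZ : translation_invariant Z)
    (scalZ : scaling_invariant r Z) j a f :
  Z f -> Z (dilate r j a f) /\ fnorm Z (dilate r j a f) = fnorm Z f.
Proof.
move=> Zf; have [Za Na] := transZ a f Zf.
have h0 : 0 < (2 : R) ^ j by rewrite exprz_gt0.
have [Zh Nh] := scalZ _ _ h0 Za.
split; first exact: in_spaceZ Zh.
rewrite /dilate (fnormZ _ Zh) Nh Na modulus_real ger0_norm ?powR_ge0 // mulrA.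
have -> : (2 : R) ^ j = 2 `^ j%:~R by rewrite powR_intmul ?ler0n.
rewrite -powRrM -powRD ?pnatr_eq0 ?implybT // mulrC mulrN [j%:~R * r]mulrC.
by rewrite subrr powRr0 mulr1.
Qed.

Lemma rescaled_norm Z f (l : nabla d) :
    translation_invariant Z -> scaling_invariant r Z -> Z f ->
  Z (rescaled r f l) /\ fnorm Z (rescaled r f l) = fnorm Z f.
Proof. by move=> transZ scalZ Zf; rewrite rescaledE; exact: dilate_norm. Qed.

Lemma dilate_sum (I : Type) (s : seq I) (P : pred I) (F : I -> func R cplx d)
    j a : dilate r j a (fun x => \sum_(i <- s | P i) F i x) =
  fun x => \sum_(i <- s | P i) dilate r j a (F i) x.
Proof. by apply/funext => x; rewrite /dilate mulr_sumr. Qed.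

Lemma dilateB j a f g : dilate r j a (fun x => f x - g x) =
  fun x => dilate r j a f x - dilate r j a g x.
Proof. by apply/funext => x; rewrite /dilate mulrBr. Qed.

End Dilations.

(** * Wavelet series *)

Section WaveletSeries.
Variables (R : realType) (cplx : bool) (d : nat) (r : R).
Variables (E : finType) (psi : E -> func R cplx d).
Implicit Types (Z : functionSpace R cplx d) (f g : func R cplx d).
Implicit Types (c : coefs R cplx d E) (v w : E -> Defs.scalar R cplx).

Definition packet (l : nabla d) v : func R cplx d :=
  fun x => \sum_(e : E) v e * rescaled r (psi e) l x.

Definition delta_coefs (l : nabla d) v : coefs R cplx d E :=
  fun l' e => if l' == l then v e else 0.

Lemma packet_dilate l v : packet l v =
  dilate r (scale_index l) (space_index R l) (fun x => \sum_(e : E) v e * psi e x).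
Proof.
apply/funext => x; rewrite /packet /dilate mulr_sumr; apply: eq_bigr => e _.
by rewrite rescaledE /dilate mulrCA.
Qed.

Lemma packetB l v w x :
  packet l v x - packet l w x = packet l (fun e => v e - w e) x.
Proof. by rewrite -sumrB; apply: eq_bigr => e _; rewrite mulrBl. Qed.

Lemma wavelet_sumE c F x :
  wavelet_sum r psi c F x = \sum_(l <- F) packet l (c l) x.
Proof. by []. Qed.

Lemma wavelet_sumB c c' F x :
  wavelet_sum r psi (fun l e => c l e - c' l e) F x =
  wavelet_sum r psi c F x - wavelet_sum r psi c' F x.
Proof. by rewrite !wavelet_sumE -sumrB; apply: eq_bigr => l _; rewrite packetB. Qed.

Lemma wavelet_sumD c c' F x :
  wavelet_sum r psi (fun l e => c l e + c' l e) F x =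
  wavelet_sum r psi c F x + wavelet_sum r psi c' F x.
Proof.
rewrite /wavelet_sum -big_split /=; apply: eq_bigr => l _.
by rewrite -big_split /=; apply: eq_bigr => e _; rewrite mulrDl.
Qed.

Lemma wavelet_sumZ a c F x :
  wavelet_sum r psi (fun l e => a * c l e) F x = a * wavelet_sum r psi c F x.
Proof.
rewrite /wavelet_sum mulr_sumr; apply: eq_bigr => l _.
by rewrite mulr_sumr; apply: eq_bigr => e _; rewrite mulrA.
Qed.

Lemma wavelet_sum_delta l v (F : {fset nabla d}) : l \in F ->
  wavelet_sum r psi (delta_coefs l v) F = packet l v.
Proof.
move=> lF; apply/funext => x; rewrite wavelet_sumE (big_fsetD1 l) //=.
rewrite [X in _ + X]big_seq_cond big1 ?addr0.
  by apply: eq_bigr => e _; rewrite /delta_coefs eqxx.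
move=> l' /andP[]; rewrite !inE => /andP[/negbTE l'l _] _.
by apply: big1 => e _; rewrite /delta_coefs l'l mul0r.
Qed.

Section OneSpace.
Variables (Z : functionSpace R cplx d).
Hypothesis psiZ : forall l e, Z (rescaled r (psi e) l).

Lemma in_packet l v : Z (packet l v).
Proof. by apply: in_space_sum => e _; apply: in_spaceZ. Qed.

Lemma in_wavelet_sum c F : Z (wavelet_sum r psi c F).
Proof. by apply: in_space_sum => l _; exact: in_packet. Qed.

Lemma wavelet_series_in c f : wavelet_series r psi Z c f -> Z f.
Proof. by case. Qed.

Lemma wavelet_series_packet l v : wavelet_series r psi Z (delta_coefs l v) (packet l v).
Proof.
split; first exact: in_packet.
move=> eps eps0; exists [fset l]%fset => F; rewrite fsub1set => lF.
rewrite wavelet_sum_delta //; under eq_fun do rewrite subrr.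
by rewrite fnorm0.
Qed.

Lemma wavelet_seriesD c c' f g : wavelet_series r psi Z c f ->
  wavelet_series r psi Z c' g ->
  wavelet_series r psi Z (fun l e => c l e + c' l e) (fun x => f x + g x).
Proof.
move=> [Zf cf] [Zg cg]; split; first exact: in_spaceD.
move=> eps eps0; have e2 : 0 < eps / 2 by rewrite divr_gt0.
have [F1 h1] := cf _ e2; have [F2 h2] := cg _ e2.
exists (F1 `|` F2)%fset => F; rewrite fsubUset => /andP[/h1 {}h1 /h2 {}h2].
rewrite (splitr eps); apply: le_lt_trans (ltrD h1 h2).
apply: le_trans (fnormD _ _); [|by apply: in_spaceB => //; exact: in_wavelet_sum..].
by under eq_fun do rewrite wavelet_sumD opprD addrACA.
Qed.

Lemma wavelet_seriesZ a c f : wavelet_series r psi Z c f ->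
  wavelet_series r psi Z (fun l e => a * c l e) (fun x => a * f x).
Proof.
move=> [Zf cf]; split; first exact: in_spaceZ.
move=> eps eps0.
have a1 : 0 < modulus a + 1 by rewrite ltr_wpDl ?modulus_ge0.
have [F0 h0] := cf (eps / (modulus a + 1)) (divr_gt0 eps0 a1).
exists F0 => F /h0; rewrite ltr_pdivlMr // => h.
under eq_fun do rewrite wavelet_sumZ -mulrBr.
have Zd := in_spaceB Zf (in_wavelet_sum c F).
rewrite fnormZ //; apply: le_lt_trans h; rewrite mulrC.
by rewrite ler_wpM2l ?fnorm_ge0 // lerDl.
Qed.

Lemma wavelet_seriesB c c' f g : wavelet_series r psi Z c f ->
  wavelet_series r psi Z c' g ->
  wavelet_series r psi Z (fun l e => c l e - c' l e) (fun x => f x - g x).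
Proof.
move=> cf cg; have := wavelet_seriesD cf (wavelet_seriesZ (-1) cg).
have -> : (fun x => f x + -1 * g x) = (fun x => f x - g x).
  by apply/funext => x; rewrite mulN1r.
have -> // : (fun l e => c l e + -1 * c' l e) = (fun l e => c l e - c' l e).
by apply/funext => l; apply/funext => e; rewrite mulN1r.
Qed.

Lemma wavelet_series0 : wavelet_series r psi Z (fun _ _ => 0) (fun=> 0).
Proof.
split=> [|eps eps0]; first exact: in_space0.
exists fset0 => F _; have -> : wavelet_sum r psi (fun _ _ => 0) F = fun=> 0.
  apply/funext => x; rewrite wavelet_sumE big1 // => l _.
  by apply: big1 => e _; rewrite mul0r.
by under eq_fun do rewrite subr0; rewrite fnorm0.
Qed.

Lemma wavelet_series_sum (I : Type) (s : seq I) (P : pred I)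
    (C : I -> coefs R cplx d E) (G : I -> func R cplx d) :
    (forall i, wavelet_series r psi Z (C i) (G i)) ->
  wavelet_series r psi Z (fun l e => \sum_(i <- s | P i) C i l e)
                         (fun x => \sum_(i <- s | P i) G i x).
Proof.
move=> CG; elim: s => [|i s ih].
  have -> : (fun x => \sum_(i <- [::] | P i) G i x) = (fun=> 0).
    by apply/funext => x; rewrite big_nil.
  have -> : (fun l e => \sum_(i <- [::] | P i) C i l e) = (fun _ _ => 0).
    by apply/funext => l; apply/funext => e; rewrite big_nil.
  exact: wavelet_series0.
have -> : (fun x => \sum_(j <- i :: s | P j) G j x) =
    if P i then (fun x => G i x + \sum_(j <- s | P j) G j x)
    else (fun x => \sum_(j <- s | P j) G j x).
  by apply/funext => x; rewrite big_cons; case: (P i).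
have -> : (fun l e => \sum_(j <- i :: s | P j) C j l e) =
    if P i then (fun l e => C i l e + \sum_(j <- s | P j) C j l e)
    else (fun l e => \sum_(j <- s | P j) C j l e).
  by apply/funext => l; apply/funext => e; rewrite big_cons; case: (P i).
by case: (P i) => //; exact: wavelet_seriesD.
Qed.

End OneSpace.

Lemma wavelet_series_embed X Y c f : continuous_embedding X Y ->
    (forall l e, X (rescaled r (psi e) l)) ->
  wavelet_series r psi X c f -> wavelet_series r psi Y c f.
Proof.
move=> [XY [C XYC]] psiX [Xf cf]; split; first exact: XY.
move=> eps eps0; have C1 : 0 < `|C| + 1 by rewrite ltr_wpDl.
have [F0 h0] := cf (eps / (`|C| + 1)) (divr_gt0 eps0 C1).
exists F0 => F /h0; rewrite ltr_pdivlMr //; apply: le_lt_trans.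
have Xd := in_spaceB Xf (in_wavelet_sum psiX c F).
apply: le_trans (XYC _ Xd) _; rewrite mulrC ler_wpM2l ?fnorm_ge0 //.
by rewrite (le_trans (ler_norm _)) // lerDl.
Qed.

Lemma coef_norm_le v w :
  (forall e, modulus (v e) <= modulus (w e)) -> coef_norm v <= coef_norm w.
Proof.
move=> vw; rewrite ler_wsqrtr //; apply: ler_sum => e _.
by rewrite lerXn2r ?nnegrE ?modulus_ge0.
Qed.

Lemma wavelet_series_finite Z c (F : {fset nabla d}) :
    (forall l e, Z (rescaled r (psi e) l)) ->
  wavelet_series r psi Z (fun l e => if l \in F then c l e else 0)
                         (wavelet_sum r psi c F).
Proof.
move=> psiZ; split; first exact: in_wavelet_sum.
move=> eps eps0; exists F => F' FF'.
have -> : wavelet_sum r psi (fun l e => if l \in F then c l e else 0) F' =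
    wavelet_sum r psi c F.
  apply/funext => x; rewrite !wavelet_sumE -(big_fset_incl _ FF').
    by apply: eq_big_seq => l lF; apply: eq_bigr => e _; rewrite lF.
  by move=> l _ /negbTE lF; apply: big1 => e _; rewrite lF mul0r.
by under eq_fun do rewrite subrr; rewrite fnorm0.
Qed.

Definition comparison_constant Z (D : R) :=
  forall c c' f g, wavelet_series r psi Z c f -> wavelet_series r psi Z c' g ->
    (forall l e, modulus (c l e) <= modulus (c' l e)) ->
    fnorm Z f <= D * fnorm Z g.

(** Passing to the limit along finite partial sums, unconditionality compares
any two convergent series, not only finite sums. Applied to coefficients that
are partly replaced by 0, it bounds the projections onto sets of wavelets. *)
Lemma basis_comparison Z : unconditional_basis r psi Z ->
  exists2 D : R, 0 < D & comparison_constant Z D.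
Proof.
move=> [psiZ _ [D0 D0P]]; pose D := `|D0| + 1.
have D_gt0 : 0 < D by rewrite ltr_wpDl.
exists D => // c c' f g [Zf cf] [Zg cg] cc'.
have key eps : 0 < eps -> fnorm Z f <= D * fnorm Z g + eps.
  move=> eps0.
  have e2 : 0 < eps / 2 by rewrite divr_gt0.
  have [F1 h1] := cf _ e2; have [F2 h2] := cg _ (divr_gt0 e2 D_gt0).
  have {}h1 := h1 _ (fsubsetUl F1 F2); have {}h2 := h2 _ (fsubsetUr F1 F2).
  set F := (F1 `|` F2)%fset in h1 h2.
  have ZF := in_wavelet_sum psiZ c F; have ZF' := in_wavelet_sum psiZ c' F.
  have h3 := fnorm_split Zf ZF; have h4 := fnorm_split ZF' Zg.
  rewrite fnormBC // in h4.
  have h5 : fnorm Z (wavelet_sum r psi c F) <= D * fnorm Z (wavelet_sum r psi c' F).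
    apply: le_trans (D0P F c c' _) _; first by move=> l _; exact: coef_norm_le.
    by rewrite ler_wpM2r ?fnorm_ge0 // (le_trans (ler_norm _)) // lerDl.
  have h6 : D * fnorm Z (wavelet_sum r psi c' F) <= D * fnorm Z g + eps / 2.
    apply: le_trans (ler_wpM2l (ltW D_gt0) h4) _; rewrite mulrDr addrC lerD2l.
    by rewrite mulrC -ler_pdivlMr // ltW.
  by move: h1 h3 h5 h6; lra.
by apply/ler_addgt0Pr.
Qed.

Lemma generator_in Z e : (forall l, Z (rescaled r (psi e) l)) -> Z (psi e).
Proof.
move=> /(_ (0, 0)); rewrite rescaledE /scale_index /space_index /=.
have -> : map_mx intr (0 : 'rV[int]_d) = 0 :> 'rV[R]_d.
  by apply/matrixP => i j; rewrite !mxE.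
by rewrite dilate_id.
Qed.

Lemma packet_norm Z l v : translation_invariant Z -> scaling_invariant r Z ->
    (forall l e, Z (rescaled r (psi e) l)) ->
  fnorm Z (packet l v) <= \sum_e modulus (v e) * fnorm Z (psi e).
Proof.
move=> transZ scalZ psiZ; apply: le_trans (fnorm_sum _ _) _.
  by move=> e _; apply: in_spaceZ.
apply: ler_sum => e _; rewrite fnormZ // rescaledE.
have Ze := generator_in (psiZ^~ e).
by have [_ ->] := dilate_norm transZ scalZ (scale_index l) (space_index R l) Ze.
Qed.

(** By comparison with a single term of the series. The bound is uniform because
all rescaled versions of [psi e] have the norm of [psi e], which is not 0: a
generator of norm 0 would give 0 two different expansions. *)
Lemma basis_coef_bound Z : translation_invariant Z -> scaling_invariant r Z ->
    unconditional_basis r psi Z ->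
  exists2 K : R, 0 < K & forall c f l e, wavelet_series r psi Z c f ->
    modulus (c l e) <= K * fnorm Z f.
Proof.
move=> transZ scalZ basisZ; have [D D_gt0 DP] := basis_comparison basisZ.
have [psiZ uniqZ _] := basisZ.
pose l0 : nabla d := (0, 0).
have psiE e l : fnorm Z (rescaled r (psi e) l) = fnorm Z (psi e).
  have Ze := generator_in (psiZ^~ e).
  by rewrite rescaledE; have [_ ->] :=
    dilate_norm transZ scalZ (scale_index l) (space_index R l) Ze.
pose one e : E -> Defs.scalar R cplx := fun e' => if e' == e then 1 else 0.
have packet_one e l a : packet l (fun e' => a * one e e') =
    fun x => a * rescaled r (psi e) l x.
  apply/funext => x; rewrite /packet (bigD1 e) //= /one eqxx mulr1 big1 ?addr0 //.
  by move=> e' /negbTE ->; rewrite mulr0 mul0r.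
have psi_gt0 e : 0 < fnorm Z (psi e).
  rewrite -(psiE e l0) lt_neqAle fnorm_ge0 // andbT eq_sym; apply/eqP => n0.
  have [c [_ cuniq]] := uniqZ _ (in_space0 Z).
  have s0 := cuniq _ (wavelet_series0 Z).
  have [_ s1] := wavelet_series_packet psiZ l0 (fun e' => 1 * one e e').
  suff /cuniq : wavelet_series r psi Z
      (delta_coefs l0 (fun e' => 1 * one e e')) (fun=> 0).
    rewrite s0 => /(congr1 (fun c => c l0 e)) /eqP.
    by rewrite /delta_coefs /one !eqxx mul1r eq_sym oner_eq0.
  split; first exact: in_space0.
  move=> eps eps0; have [F0 F0P] := s1 _ eps0; exists F0 => F FF.
  have {}F0P := F0P _ FF.
  have Zs := in_wavelet_sum psiZ (delta_coefs l0 (fun e' => 1 * one e e')) F.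
  have Zp := in_packet psiZ l0 (fun e' => 1 * one e e').
  have p0 : fnorm Z (packet l0 (fun e' => 1 * one e e')) = 0.
    by rewrite packet_one fnormZ // n0 mulr0.
  apply: le_lt_trans (fnorm_distD (in_space0 Z) Zp Zs) _.
  rewrite fnormBC //; last exact: in_space0.
  by under eq_fun do rewrite subr0; rewrite p0 add0r.
pose K := 1 + \sum_e D / fnorm Z (psi e).
have K0 e : 0 <= D / fnorm Z (psi e) by rewrite divr_ge0 // ltW.
exists K => [|c f l e cf].
  by rewrite ltr_wpDr ?ltr01 // sumr_ge0.
have eK : D / fnorm Z (psi e) <= K.
  by rewrite /K (bigD1 e) //= addrCA lerDl addr_ge0 // sumr_ge0.
have Zf := wavelet_series_in cf.
apply: le_trans (ler_wpM2r (fnorm_ge0 Zf) eK).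
rewrite mulrAC ler_pdivlMr //.
have := DP _ _ _ _ (wavelet_series_packet psiZ l (fun e' => c l e * one e e')) cf _.
rewrite packet_one fnormZ // psiE; apply => l' e'; rewrite /delta_coefs /one.
case: eqP => [->|_]; last by rewrite modulus0 modulus_ge0.
by case: eqP => [->|_]; rewrite ?mulr1 // mulr0 modulus0 modulus_ge0.
Qed.

End WaveletSeries.

(** * Limits of bounded sequences of X that are Cauchy in Y *)

Section ClosureInX.
Variables (R : realType) (cplx : bool) (d : nat) (r : R).
Variables (X Y : functionSpace R cplx d).
Variables (E : finType) (psi : E -> func R cplx d).
Hypotheses (embXY : continuous_embedding X Y).
Hypotheses (transY : translation_invariant Y) (scalY : scaling_invariant r Y).
Hypotheses (basisX : unconditional_basis r psi X).
Hypotheses (basisY : unconditional_basis r psi Y).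
Hypothesis limX : coefficientwise_limit_bound r psi X.

(** The Cauchy condition in Y makes the coefficients of [S N] converge, and the
bound in X makes the limit coefficients those of a function of X: the limit is
built in X, and only then compared with [S N] in Y. *)
Lemma cauchy_limit_in_X (S : nat -> func R cplx d) :
    bounded_seq_in X S ->
    (forall eps : R, 0 < eps -> exists N0 : nat, forall N N',
       (N0 <= N)%N -> (N <= N')%N -> fnorm Y (fun x => S N x - S N' x) <= eps) ->
  exists2 g, X g & (fun N => fnorm Y (fun x => S N x - g x)) @ \oo --> (0 : R).
Proof.
move=> S_bounded S_cauchy; have [SX _] := S_bounded.
have [psiX exX _] := basisX; have [psiY _ _] := basisY.
have SY N : Y (S N) by exact: embXY.1.
have [c cS] : {c : nat -> coefs R cplx d E &
    forall N, wavelet_series r psi X (c N) (S N)}.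
  apply: (@boolp.choice _ _ (fun N c => wavelet_series r psi X c (S N))) => N.
  by have [c [cS _]] := exX _ (SX N); exists c.
have cSY N : wavelet_series r psi Y (c N) (S N) by exact: wavelet_series_embed (cS N).
have [K K0 KP] := basis_coef_bound transY scalY basisY.
have [c0 c0P] : exists c0 : nabla d -> E -> Defs.scalar R cplx,
    forall l e, (fun N => modulus (c N l e - c0 l e)) @ \oo --> (0 : R).
  have ex le : exists z, (fun N => modulus (c N le.1 le.2 - z)) @ \oo --> (0 : R).
    apply: scalar_complete => eps eps0.
    have [N0 N0P] := S_cauchy _ (divr_gt0 eps0 K0).
    exists N0 => N N' h h'.
    have cNN' := wavelet_seriesB psiY (cSY N) (cSY N').
    apply: le_trans (KP _ _ le.1 le.2 cNN') _.
    by rewrite mulrC -ler_pdivlMr // N0P.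
  have [c0 c0P] := boolp.choice ex.
  by exists (fun l e => c0 (l, e)) => l e; exact: c0P (l, e).
have [C CP] := limX; have [g c0g _] := CP S c c0 S_bounded cS c0P.
have gX := wavelet_series_in c0g; exists g => //.
have gY := embXY.1 _ gX.
have c0gY : wavelet_series r psi Y c0 g by exact: wavelet_series_embed c0g.
have [D D0 DP] := basis_comparison basisY.
apply/cvgr0Pnorm_le => eps eps0; have e2 : 0 < eps / 2 by rewrite divr_gt0.
have [N0 N0P] := S_cauchy _ (divr_gt0 e2 D0).
exists N0 => // N /= N0N; rewrite ger0_norm; last first.
  by apply: fnorm_ge0; exact: in_spaceB.
(* As N' grows, [S N'] is so far known to tend to g only coefficient by
   coefficient; so the bound on [S N - S N'] passes first to the finite partial
   sums of [S N - g], and from them to [S N - g]. *)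
have [Zd sd] := wavelet_seriesB psiY (cSY N) c0gY.
apply/ler_addgt0Pr => eta eta0; have n2 : 0 < eta / 2 by rewrite divr_gt0.
have [F FP] := sd _ n2; have {}FP := FP F (fsubset_refl F).
pose w N' : func R cplx d := wavelet_sum r psi (fun l e => c N' l e - c0 l e) F.
have w0 : (fun N' => fnorm Y (w N')) @ \oo --> (0 : R).
  have s0 : (fun N' => \sum_(l <- F) \sum_e
      modulus (c N' l e - c0 l e) * fnorm Y (psi e)) @ \oo --> (0 : R).
    apply: cvg_sum0 => l _; apply: cvg_sum0 => e _.
    by have := cvgM (c0P l e) (cvg_cst (fnorm Y (psi e))); rewrite mul0r; exact.
  apply: squeeze_cvgr s0; last exact: cvg_cst.
  near=> N'; rewrite fnorm_ge0 ?/=; last exact: in_wavelet_sum.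
  apply: le_trans (fnorm_sum _ _) _ => [l _|]; first exact: in_packet.
  by apply: ler_sum => l _; exact: packet_norm.
have [N1 _ N1P] := (cvgr0Pnorm_le _).1 w0 _ n2.
pose N' := maxn N N1; have /= wN' := N1P N' (leq_maxr N N1).
have NN' : (N <= N')%N by exact: leq_maxl.
have ww : wavelet_sum r psi (fun l e => c N l e - c0 l e) F = (fun x =>
    wavelet_sum r psi (fun l e => c N l e - c N' l e) F x + w N' x).
  by apply/funext => x; rewrite /w !wavelet_sumB addrA subrK.
have wNN' : fnorm Y (wavelet_sum r psi (fun l e => c N l e - c N' l e) F) <= eps / 2.
  have cNN' := wavelet_seriesB psiY (cSY N) (cSY N').
  apply: le_trans (DP _ _ _ _ (wavelet_series_finite _ F psiY) cNN' _) _.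
    by move=> l e; case: ifP => // _; rewrite modulus0 modulus_ge0.
  by rewrite mulrC -ler_pdivlMr // N0P.
have h1 := fnorm_split Zd (in_wavelet_sum psiY (fun l e => c N l e - c0 l e) F).
have h2 : fnorm Y (wavelet_sum r psi (fun l e => c N l e - c0 l e) F) <=
    eps / 2 + eta / 2.
  rewrite ww; apply: le_trans (fnormD _ _) _; [exact: in_wavelet_sum..|].
  apply: lerD => //; apply: le_trans wN'; exact: ler_norm.
by move: FP h1 h2; lra.
Unshelve. all: end_near.
Qed.

End ClosureInX.

(** * Sums along an enumeration of the wavelets *)

(** Sets for different M may fail to be nested. Listed one after the other without
repetition, they place the M-th one among the first 1 + ... + M <= M ^ 2 terms:
this rank depends on the cardinalities only, so that for a sequence of functions
one cut-off is good for all of them. *)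
Lemma enumerate_fsets (T : choiceType) (F : nat -> {fset T}) :
    (forall M, (0 < M)%N -> #|` F M| = M) ->
  exists2 en : nat -> T, injective en &
    forall M l, (0 < M)%N -> l \in F M -> exists2 m, (m < M ^ 2)%N & en m = l.
Proof.
move=> cardF.
have [x0 _] : exists x0, x0 \in F 1%N.
  have : F 1%N != fset0 by rewrite -cardfs_gt0 cardF.
  by move=> /fset0Pn [x ?]; exists x.
pose s := fix s M := if M is M'.+1 then
  s M' ++ [seq x <- F M | x \notin s M'] else [::].
have sS M : s M.+1 = s M ++ [seq x <- F M.+1 | x \notin s M] by [].
have s_uniq M : uniq (s M).
  elim: M => // M ih; rewrite sS cat_uniq ih filter_uniq ?fset_uniq // andbT.
  by apply/hasPn => x; rewrite mem_filter => /andP[].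
have s_size M : (size (s M) <= M ^ 2)%N.
  elim: M => // M ih; rewrite sS size_cat size_filter.
  have h := count_size (fun x => x \notin s M) (F M.+1).
  have := cardF M.+1 isT; rewrite cardfE -cardfE => cF.
  rewrite cF in h.
  by apply: leq_trans (leq_add ih h) _; rewrite !expnS !expn0; lia.
have Fs M x : (0 < M)%N -> x \in F M -> x \in s M.
  case: M => // M _ xF; rewrite sS mem_cat mem_filter.
  by case: (x \in s M); rewrite //= xF.
have s_ge M : (M <= size (s M))%N.
  case: M => // M; rewrite -{1}(cardF M.+1 isT); apply: uniq_leq_size.
    exact: fset_uniq.
  by move=> x; exact: Fs.
have nth_s M k m : (m < size (s M))%N -> nth x0 (s (M + k)%N) m = nth x0 (s M) m.
  elim: k => [|k ih] mM; first by rewrite addn0.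
  rewrite addnS sS nth_cat ih // ifT //.
  elim: k {ih} => [|k ih]; first by rewrite addn0.
  by rewrite addnS sS size_cat; apply: leq_trans ih (leq_addr _ _).
pose en m := nth x0 (s m.+1) m.
have enE M m : (m < size (s M))%N -> nth x0 (s M) m = en m.
  move=> mM; rewrite /en; have [h|h] := leqP M m.+1.
    by rewrite -(subnKC h) nth_s.
  by rewrite -(subnKC (ltnW h)) nth_s // s_ge.
exists en.
  move=> m m' emm'; pose M := (maxn m m').+1.
  have mM : (m < size (s M))%N by apply: leq_trans (s_ge M); rewrite ltnS leq_maxl.
  have mM' : (m' < size (s M))%N by apply: leq_trans (s_ge M); rewrite ltnS leq_maxr.
  by apply/eqP; rewrite -(nth_uniq x0 mM mM' (s_uniq M)) !enE // emm'.
move=> M l M0 lF; have ls := Fs _ _ M0 lF; exists (index l (s M)).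
  by apply: leq_trans (s_size M); rewrite index_mem.
by rewrite -(enE M) ?index_mem // nth_index.
Qed.

Section EnumeratedSums.
Variables (R : realType) (cplx : bool) (d : nat) (r : R).
Variables (E : finType) (psi : E -> func R cplx d).
Variables (en : nat -> nabla d) (en_inj : injective en).
Implicit Types (a : nat -> E -> Defs.scalar R cplx) (I : pred nat).
Variables (Z : functionSpace R cplx d).
Hypotheses (transZ : translation_invariant Z) (scalZ : scaling_invariant r Z).
Hypothesis psiZ : forall l e, Z (rescaled r (psi e) l).
Variables (D : R) (DP : comparison_constant r psi Z D).

Definition enum_sum I K a : func R cplx d :=
  fun x => \sum_(0 <= m < K | I m) packet r psi (en m) (a m) x.

Lemma in_enum_sum I K a : Z (enum_sum I K a).
Proof. by apply: in_space_sum => m _; exact: in_packet. Qed.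

Lemma enum_sumB I K a b x :
  enum_sum I K a x - enum_sum I K b x = enum_sum I K (fun m e => a m e - b m e) x.
Proof. by rewrite /enum_sum -sumrB; apply: eq_bigr => m _; rewrite packetB. Qed.

Lemma enum_sum_norm I K a : fnorm Z (enum_sum I K a) <=
  \sum_(0 <= m < K | I m) \sum_e modulus (a m e) * fnorm Z (psi e).
Proof.
apply: le_trans (fnorm_sum _ _) _ => [m _|]; first exact: in_packet.
by apply: ler_sum => m _; exact: packet_norm.
Qed.

Definition enum_coefs I K a : coefs R cplx d E :=
  fun l e => \sum_(0 <= m < K | I m) delta_coefs (en m) (a m) l e.

Lemma series_enum_sum I K a :
  wavelet_series r psi Z (enum_coefs I K a) (enum_sum I K a).
Proof. by apply: wavelet_series_sum => // m; exact: wavelet_series_packet. Qed.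

Lemma enum_coefs_en I K a m e :
  enum_coefs I K a (en m) e = if (m < K)%N && I m then a m e else 0.
Proof.
rewrite /enum_coefs /delta_coefs; case: ifP => [/andP[mK Im]|h].
  rewrite big_mkcond /= (bigD1_seq m) ?iota_uniq ?mem_index_iota //= Im eqxx.
  rewrite big1 ?addr0 // => i im; case: ifP => // _.
  by rewrite ifF //; apply/eqP => /en_inj mi; rewrite mi eqxx in im.
rewrite big_seq_cond big1 // => i; rewrite mem_index_iota /= => /andP[iK Ii].
rewrite ifF //; apply/eqP => /en_inj mi; subst i.
by rewrite iK Ii in h.
Qed.

Lemma enum_coefs_out I K a l e : (forall m, en m <> l) -> enum_coefs I K a l e = 0.
Proof.
move=> lout; rewrite /enum_coefs /delta_coefs big1 // => m _.
by rewrite ifF //; apply/eqP => ml; exact: (lout m).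
Qed.

(** The coefficients on the left are among those of the truncation error on the
right: the best approximation rate thus controls every sub-sum of the tail. *)
Lemma enum_tail_le I K K0 c f : wavelet_series r psi Z c f ->
    (forall m, I m -> (K0 <= m)%N) ->
  fnorm Z (enum_sum I K (fun m => c (en m))) <=
  D * fnorm Z (fun x => f x - enum_sum predT K0 (fun m => c (en m)) x).
Proof.
move=> cf IK0.
apply: DP (series_enum_sum _ _ _)
  (wavelet_seriesB psiZ cf (series_enum_sum _ _ _)) _.
move=> l e; have [[m <-]|lout] := pselect (exists m, en m = l).
  rewrite !enum_coefs_en andbT; case: ifP => [/andP[_ /IK0 h]|_].
    by rewrite ltnNge h /= subr0.
  by rewrite modulus0 modulus_ge0.
by rewrite enum_coefs_out ?modulus0 ?modulus_ge0 // => m ml; apply: lout; exists m.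
Qed.

(** Keeping more wavelets than those of [F] spoils the approximation at most by
the comparison constant. *)
Lemma enum_approx_le K0 c f (F : {fset nabla d}) : wavelet_series r psi Z c f ->
    (forall l, l \in F -> exists2 m, (m < K0)%N & en m = l) ->
  fnorm Z (fun x => f x - enum_sum predT K0 (fun m => c (en m)) x) <=
  D * fnorm Z (fun x => f x - wavelet_sum r psi c F x).
Proof.
move=> cf FK0.
apply: DP (wavelet_seriesB psiZ cf (series_enum_sum _ _ _))
  (wavelet_seriesB psiZ cf (wavelet_series_finite _ F psiZ)) _.
move=> l e; case: ifP => [/FK0 [m mK0 <-]|_].
  by rewrite enum_coefs_en mK0 /= subrr.
rewrite subr0; have [[m <-]|lout] := pselect (exists m, en m = l).
  by rewrite enum_coefs_en; case: ifP => _; rewrite ?subrr ?modulus0 ?modulus_ge0 ?subr0.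
by rewrite enum_coefs_out ?subr0 // => m ml; apply: lout; exists m.
Qed.

End EnumeratedSums.

(** * Relative positions *)

Section RelativePositions.
Variables (R : realType) (d : nat).
Implicit Types l : nabla d.

Definition relpos l l' : int * 'rV[R]_d :=
  (scale_index l - scale_index l',
   space_index R l -
     (2 : R) ^ (scale_index l - scale_index l') *: space_index R l').

Lemma relpos_self l : relpos l l = (0, 0).
Proof. by rewrite /relpos !subrr expr0z scale1r subrr. Qed.

Lemma relpos_sym l l' : relpos l' l =
  (- (relpos l l').1, - ((2 : R) ^ (- (relpos l l').1) *: (relpos l l').2)).
Proof.
rewrite /relpos /= opprB scalerBr scalerA -expfzDr ?pnatr_eq0 //.
have -> : scale_index l' - scale_index l + (scale_index l - scale_index l') = 0.
  by ring.
by rewrite expr0z scale1r opprB.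
Qed.

Lemma relpos_trans l l' l'' : relpos l l'' =
  ((relpos l l').1 + (relpos l' l'').1,
   (relpos l l').2 + (2 : R) ^ (relpos l l').1 *: (relpos l' l'').2).
Proof.
rewrite /relpos /= scalerBr scalerA -expfzDr ?pnatr_eq0 //.
have -> : scale_index l - scale_index l' + (scale_index l' - scale_index l'') =
  scale_index l - scale_index l'' by ring.
by rewrite addrA subrK.
Qed.

Lemma coord_le_enorm (v : 'rV[R]_d) i : `|v 0 i| <= enorm v.
Proof.
rewrite -sqrtr_sqr ler_wsqrtr // (bigD1 i) //= lerDl sumr_ge0 // => j _.
exact: sqr_ge0.
Qed.

(** When both the scale difference and the displacement stay bounded, the scale
difference takes finitely many values, hence is constant along [U]; then the
displacement, up to a fixed power of 2, is a bounded integer vector, hence is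
constant too. *)
Lemma relpos_dichotomy (U : set_system nat) (z z' : nat -> nabla d) :
    UltraFilter U ->
  [\/ exists p, U [set n | relpos (z n) (z' n) = p],
      forall K : nat,
        U [set n | K%:R <= `|scale_index (z n) - scale_index (z' n)|%:~R :> R] |
      forall K : nat, U [set n | K%:R <= enorm (relpos (z n) (z' n)).2]].
Proof.
move=> UU.
have [hj|] := pselect (forall K : nat,
    U [set n | K%:R <= `|scale_index (z n) - scale_index (z' n)|%:~R :> R]).
  by apply: Or32.
move=> /existsNP [K hK].
have [hk|] := pselect (forall K : nat, U [set n | K%:R <= enorm (relpos (z n) (z' n)).2]).
  by apply: Or33.
move=> /existsNP [K' hK']; apply: Or31.
have ultraC A : ~ U A -> U (~` A) by case: (in_ultra_setVsetC A UU).
have [delta zdelta] : exists delta,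
    U [set n | scale_index (z n) - scale_index (z' n) = delta].
  apply: (@ultra_bounded_int U UU _ K%:Z); apply: filterS (ultraC _ hK) => n /= /negP.
  by rewrite -ltNge -[K%:R]/((K%:Z)%:~R) ltr_int => /ltW.
pose N : int := 2 ^+ `|delta|%N.
pose N' : int := 2 ^+ absz (`|delta| + delta).
have N_neq0 : N%:~R != 0 :> R by rewrite intr_eq0 expf_neq0.
pose w i n : int := N * (z n).2 0 i - N' * (z' n).2 0 i.
have wE i n : scale_index (z n) - scale_index (z' n) = delta ->
    (w i n)%:~R = N%:~R * (relpos (z n) (z' n)).2 0 i.
  move=> zn; rewrite /relpos /= zn !mxE mulrBr mulrA rmorphB !rmorphM /=.
  congr (_ - _ * _); rewrite /N /N' !rmorphXn /= !exprnP -expfzDr ?pnatr_eq0 //.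
  by congr (_ ^ _); lia.
have wc i : exists c, U [set n | w i n = c].
  apply: (@ultra_bounded_int U UU _ (N * K'%:Z)).
  apply: filterS (filterI zdelta (ultraC _ hK')) => n /= [zn /negP].
  rewrite -ltNge => zn'; rewrite -(ler_int R) intr_norm wE // normrM rmorphM /=.
  have N0 : 0 < N%:~R :> R by rewrite ltr0z exprn_gt0.
  rewrite gtr0_norm // ler_pM2l //; apply: le_trans (coord_le_enorm _ _) _.
  exact: ltW.
have [c cP] := boolp.choice wc.
exists (delta, \row_i ((c i)%:~R / N%:~R)).
have wall : U [set n | forall i, w i n = c i].
  by apply: (@filter_forall _ _ (fun i n => w i n = c i) U).
apply: filterS (filterI zdelta wall) => n /= [zn wn].
rewrite [LHS]surjective_pairing; congr (_, _); first exact: zn.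
apply/rowP => i; rewrite [RHS]mxE -wn wE //.
by rewrite mulrAC divff // mul1r.
Qed.

Variables (cplx : bool) (r : R) (E : finType) (psi : E -> func R cplx d).

Definition relative_packet (p : int * 'rV[R]_d) (v : E -> Defs.scalar R cplx) :
    func R cplx d :=
  dilate r p.1 p.2 (fun x => \sum_(e : E) v e * psi e x).

Lemma packet_relative l l' v :
  packet r psi l v = rescaled r (relative_packet (relpos l l') v) l'.
Proof.
rewrite rescaledE /relative_packet dilate_comp packet_dilate /relpos /=.
by rewrite addrCA subrr addr0 addrCA subrr addr0.
Qed.

End RelativePositions.

(** * Profiles and remainders along the extracted subsequence *)

Section Profiles.
Variables (R : realType) (cplx : bool) (d : nat) (r : R).
Variables (X Y : functionSpace R cplx d).
Variables (E : finType) (psi : E -> func R cplx d).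
Hypotheses (embXY : continuous_embedding X Y).
Hypotheses (transX : translation_invariant X) (scalX : scaling_invariant r X).
Hypotheses (transY : translation_invariant Y) (scalY : scaling_invariant r Y).
Hypotheses (basisX : unconditional_basis r psi X).
Hypotheses (basisY : unconditional_basis r psi Y).
Hypothesis limX : coefficientwise_limit_bound r psi X.

Variables (v : nat -> func R cplx d) (c : nat -> coefs R cplx d E) (B : R).
Hypothesis v_le : forall n, fnorm X (v n) <= B.
Hypothesis c_series : forall n, wavelet_series r psi X (c n) (v n).
Variable en : nat -> nat -> nabla d.
Hypothesis en_inj : forall n, injective (en n).
Hypothesis en_approx : forall eps : R, 0 < eps ->
  exists K0, forall K n, (K0 <= K)%N -> fnorm Y (fun x =>
    v n x - enum_sum r psi (en n) predT K (fun m => c n (en n m)) x) <= eps.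
Variable a : nat -> E -> Defs.scalar R cplx.
Hypothesis a_lim : forall m e,
  (fun n => modulus (c n (en n m) e - a m e)) @ \oo --> (0 : R).
Variables (p : nat -> nat) (q : nat -> int * 'rV[R]_d).
Hypotheses (p_le : forall m, (p m <= m)%N) (p_idem : forall m, p (p m) = p m).
Hypothesis q_pos : forall m,
  \forall n \near \oo, relpos R (en n m) (en n (p m)) = q m.

Let psiX : forall l e, X (rescaled r (psi e) l). Proof. by case: basisX. Qed.
Let psiY : forall l e, Y (rescaled r (psi e) l). Proof. by case: basisY. Qed.

Let W n I K := enum_sum r psi (en n) I K a.

(** For finitely many ranks, the coefficients may be replaced by their limits:
the norm of a wavelet does not depend on its position. *)
Lemma limit_coefs_cvg Z I K : translation_invariant Z -> scaling_invariant r Z ->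
    (forall l e, Z (rescaled r (psi e) l)) ->
  (fun n => fnorm Z (fun x =>
     enum_sum r psi (en n) I K (fun m => c n (en n m)) x - W n I K x))
    @ \oo --> (0 : R).
Proof.
move=> transZ scalZ psiZ.
have s0 : (fun n => \sum_(0 <= m < K | I m) \sum_e
    modulus (c n (en n m) e - a m e) * fnorm Z (psi e)) @ \oo --> (0 : R).
  apply: cvg_sum0 => m _; apply: cvg_sum0 => e _.
  by have := cvgM (a_lim m e) (cvg_cst (fnorm Z (psi e))); rewrite mul0r; exact.
apply: squeeze_cvgr s0; last exact: cvg_cst.
near=> n; rewrite fnorm_ge0 /=; last by apply: in_spaceB; exact: in_enum_sum.
rewrite /W; under eq_fun do rewrite enum_sumB.
exact: enum_sum_norm.
Unshelve. all: end_near.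
Qed.

Lemma partial_sum_X : exists B', forall (I : pred nat) K,
  \forall n \near \oo, fnorm X (W n I K) <= B'.
Proof.
have [D D0 DP] := basis_comparison basisX; exists (D * B + 1) => I K.
have h := (cvgr0Pnorm_le _).1 (limit_coefs_cvg I K transX scalX psiX) _ ltr01.
have [N _ hN] := h; exists N => // n /= /hN /= hn.
have Xe b : X (enum_sum r psi (en n) I K b) by exact: in_enum_sum.
apply: le_trans (fnorm_split (Xe _) (Xe (fun m => c n (en n m)))) _.
rewrite addrC lerD //; last first.
  by rewrite fnormBC //; apply: le_trans hn; exact: ler_norm.
apply: le_trans (enum_tail_le (@en_inj n) psiX DP (K0 := 0) _ (c_series n) _) _ => //.
rewrite ler_pM2l //; have -> : (fun x => v n x -
    enum_sum r psi (en n) predT 0 (fun m => c n (en n m)) x) = v n.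
  by apply/funext => x; rewrite /enum_sum big_geq // subr0.
exact: v_le.
Qed.

Lemma partial_sum_Y (eps : R) : 0 < eps -> exists K0 : nat, forall (I : pred nat) K,
  (forall m, I m -> (K0 <= m)%N) ->
  \forall n \near \oo, fnorm Y (W n I K) <= eps.
Proof.
move=> eps0; have e2 : 0 < eps / 2 by rewrite divr_gt0.
have [D D0 DP] := basis_comparison basisY.
have [K0 K0P] := en_approx (divr_gt0 e2 D0).
exists K0 => I K IK0.
have h := (cvgr0Pnorm_le _).1 (limit_coefs_cvg I K transY scalY psiY) _ e2.
have [N _ hN] := h; exists N => // n /= /hN /= hn.
have Ye b : Y (enum_sum r psi (en n) I K b) by exact: in_enum_sum.
apply: le_trans (fnorm_split (Ye _) (Ye (fun m => c n (en n m)))) _.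
rewrite addrC (splitr eps) lerD //; last first.
  by rewrite fnormBC //; apply: le_trans hn; exact: ler_norm.
have cY : wavelet_series r psi Y (c n) (v n) by exact: wavelet_series_embed (c_series n).
apply: le_trans (enum_tail_le (@en_inj n) psiY DP _ cY IK0) _.
by rewrite mulrC -ler_pdivlMr // K0P.
Qed.

Let profile_sum (I : pred nat) K : func R cplx d :=
  fun x => \sum_(0 <= m < K | I m) relative_packet r psi (q m) (a m) x.

Lemma in_profile_sum Z I K : translation_invariant Z -> scaling_invariant r Z ->
  (forall l e, Z (rescaled r (psi e) l)) -> Z (profile_sum I K).
Proof.
move=> transZ scalZ psiZ; apply: in_space_sum => m _.
have Zs : Z (fun x => \sum_e a m e * psi e x).
  by apply: in_space_sum => e _; apply: in_spaceZ; exact: generator_in.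
by have [] := dilate_norm transZ scalZ (q m).1 (q m).2 Zs.
Qed.

Lemma rescaled_profile_sum l (I : pred nat) K : (forall m, I m -> p m = l) ->
  \forall n \near \oo, rescaled r (profile_sum I K) (en n l) = W n I K.
Proof.
move=> Il.
have h : \forall n \near \oo, forall m : 'I_K, relpos R (en n m) (en n (p m)) = q m.
  by apply: filter_forall => m; exact: q_pos.
have [N _ hN] := h; exists N => // n /= /hN /= hn.
rewrite rescaledE dilate_sum; apply/funext => x.
rewrite /W /enum_sum !big_mkord; apply: eq_bigr => m /Il pm.
by rewrite -rescaledE (packet_relative _ _ (en n m) (en n l)) -pm hn.
Qed.

(** Carried to [en n l] with n large, a partial sum of the profile is a sub-sum
of the limit expansion, with the same norm by invariance: the partial sums are
bounded in X and Cauchy in Y. *)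
Lemma profile_exists l : exists2 phi : func R cplx d, X phi &
  (fun K => fnorm Y (fun x => profile_sum (fun m => p m == l) K x - phi x))
    @ \oo --> (0 : R).
Proof.
have SX I K : X (profile_sum I K) by exact: in_profile_sum.
have SY I K : Y (profile_sum I K) by exact: in_profile_sum.
apply: (cauchy_limit_in_X embXY transY scalY basisX basisY limX).
  split=> [K|]; first exact: SX.
  have [B' B'P] := partial_sum_X; exists B' => K.
  have hp m : p m == l -> p m = l by move/eqP.
  have [n [h1 h2]] := filter_ex (filterI (rescaled_profile_sum K hp)
    (B'P (fun m => p m == l) K)).
  have [_ <-] :=
    rescaled_norm (en n l) transX scalX (SX (fun m => p m == l) K).
  by rewrite h1.
move=> eps eps0; have [K0 K0P] := partial_sum_Y eps0.
exists K0 => K K' K0K KK'; pose I m := (p m == l) && (K <= m)%N.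
have -> : (fun x => profile_sum (fun m => p m == l) K x -
    profile_sum (fun m => p m == l) K' x) = (fun x => - profile_sum I K' x).
  apply/funext => x; rewrite /profile_sum -opprB; congr (- _).
  rewrite (big_cat_nat _ (n := K)) //= addrAC subrr add0r.
  rewrite [in RHS](big_cat_nat _ (n := K)) //= [X in _ = X + _]big1_seq ?add0r.
    rewrite [LHS]big_nat_cond [RHS]big_nat_cond; apply: eq_bigl => m.
    by rewrite /I; case: (K <= m)%N; rewrite ?andbT.
  by move=> m /andP[/andP[_ Km]]; rewrite mem_index_iota ltnNge Km andbF.
rewrite fnormN //.
have hI m : I m -> p m = l by move=> /andP[/eqP].
have IK0 m : I m -> (K0 <= m)%N by move=> /andP[_]; exact: leq_trans.
have [n [h1 h2]] := filter_ex (filterI (rescaled_profile_sum K' hI)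
  (K0P I K' IK0)).
by have [_ <-] := rescaled_norm (en n l) transY scalY (SY I K'); rewrite h1.
Qed.


Lemma sum_classes (V : nmodType) (t : nat -> V) L K :
  \sum_(0 <= m < K) t m =
  \sum_(l < L) \sum_(0 <= m < K | p m == l) t m +
  \sum_(0 <= m < K | (L <= p m)%N) t m.
Proof.
under [X in _ = X + _]eq_bigr do rewrite big_mkcond.
rewrite exchange_big /= [X in _ = _ + X]big_mkcond -big_split /=.
apply: eq_bigr => m _; case: leqP => [Lp|pL].
  by rewrite big1 ?add0r // => l _; rewrite ifF //; apply/eqP; have := ltn_ord l; lia.
rewrite addr0 (bigD1 (Ordinal pL)) //= eqxx big1 ?addr0 // => l lp.
by rewrite ifF //; apply: contraNF lp => /eqP pl; apply/eqP/val_inj.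
Qed.

(** The remainder splits into the terms after rank M, the error on the first M
coefficients, the tails of the first L profiles, and the terms of rank below M
belonging to later profiles; these have rank at least L since [p m <= m]. First
L, then M, then n are taken large. *)
Lemma profile_remainder : exists2 phi : nat -> func R cplx d,
  forall l, X (phi l) &
  forall lam : nat -> nat -> nabla d,
    (forall l n, p l = l -> lam l n = en n l) ->
    forall eps : R, 0 < eps -> exists L0, forall L, (L0 <= L)%N ->
    \forall n \near \oo, fnorm Y (fun x =>
      v n x - \sum_(l < L) rescaled r (phi l) (lam l n) x) <= eps.
Proof.
have ex l : exists phi : func R cplx d, X phi /\
    (fun K => fnorm Y (fun x => profile_sum (fun m => p m == l) K x - phi x))
      @ \oo --> (0 : R).
  by have [phi h1 h2] := profile_exists l; exists phi.
have [phi phiP] := boolp.choice ex.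
have phiX l : X (phi l) by case: (phiP l).
have phiY l : Y (phi l) by exact: embXY.1.
exists phi => // lam lamE eps eps0.
have e4 : 0 < eps / 4 by rewrite divr_gt0.
have [L0 L0P] := partial_sum_Y e4; exists L0 => L L0L.
have [K0 K0P] := en_approx e4.
have tails : (fun K => \sum_(l < L) fnorm Y (fun x =>
    profile_sum (fun m => p m == l) K x - phi l x)) @ \oo --> (0 : R).
  by apply: cvg_sum0 => l _; case: (phiP l).
have [K1 _ K1P] := (cvgr0Pnorm_le _).1 tails _ e4.
pose M := maxn K0 K1.
have {K1P} hM := le_trans (ler_norm _) (K1P M (leq_maxr _ _)).
have late m : (L <= p m)%N -> (L0 <= m)%N.
  by move=> h; apply: leq_trans L0L (leq_trans h (p_le m)).
have [N1 _ hN1] := L0P (fun m => (L <= p m)%N) M late.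
have [N2 _ hN2] := (cvgr0Pnorm_le _).1
  (limit_coefs_cvg predT M transY scalY psiY) _ e4.
have [N3 _ hN3] : \forall n \near \oo, forall l : 'I_L,
    rescaled r (profile_sum (fun m => p m == l) M) (en n l) =
    W n (fun m => p m == l) M.
  by apply: filter_forall => l; apply: rescaled_profile_sum => m /eqP.
exists (maxn N1 (maxn N2 N3)) => // n /=; rewrite !geq_max => /and3P[n1 n2 n3].
pose S (l : nat) := profile_sum (fun m => p m == l) M.
have SY l : Y (S l) by exact: in_profile_sum.
have SE (l : 'I_L) : rescaled r (S l) (lam l n) = W n (fun m => p m == l) M.
  have [pl|pl] := eqVneq (p l) l; first by rewrite lamE // hN3.
  have none m : (p m == l) = false.
    by apply/negbTE; apply: contraNneq pl => <-; rewrite p_idem.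
  apply/funext => x; rewrite /W /enum_sum big1 => [|m]; last by rewrite none.
  by rewrite /rescaled /S /profile_sum big1 ?mulr0 // => m; rewrite none.
pose T1 : func R cplx d := fun x =>
  v n x - enum_sum r psi (en n) predT M (fun m => c n (en n m)) x.
pose T2 : func R cplx d := fun x =>
  enum_sum r psi (en n) predT M (fun m => c n (en n m)) x - W n predT M x.
pose T3 : func R cplx d := fun x => \sum_(l < L)
  (rescaled r (fun y => S l y - phi l y) (lam l n) x).
pose T4 := W n (fun m => (L <= p m)%N) M.
have vY : Y (v n) by apply: embXY.1; exact: wavelet_series_in (c_series n).
have T1Y : Y T1 by apply: in_spaceB => //; exact: in_enum_sum.
have T2Y : Y T2 by apply: in_spaceB; exact: in_enum_sum.
have Sphi l : Y (fun y => S l y - phi l y) by exact: in_spaceB.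
have T3Y : Y T3.
  by apply: in_space_sum => l _; case: (rescaled_norm (lam l n) transY scalY (Sphi l)).
have T4Y : Y T4 by exact: in_enum_sum.
have -> : (fun x => v n x - \sum_(l < L) rescaled r (phi l) (lam l n) x) =
    (fun x => (T1 x + T2 x) + (T3 x + T4 x)).
  apply/funext => x.
  have -> : T3 x = \sum_(l < L) W n (fun m => p m == l) M x -
      \sum_(l < L) rescaled r (phi l) (lam l n) x.
    rewrite -sumrB; apply: eq_bigr => l _.
    by rewrite -SE !rescaledE dilateB.
  rewrite /T1 /T2 /T4.
  have -> : W n predT M x = \sum_(l < L) W n (fun m => p m == l) M x +
      W n (fun m => (L <= p m)%N) M x by exact: sum_classes.
  by ring.
have h1 : fnorm Y T1 <= eps / 4 by apply: K0P; exact: leq_maxl.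
have h2 : fnorm Y T2 <= eps / 4 by apply: le_trans (hN2 n n2); exact: ler_norm.
have h3 : fnorm Y T3 <= eps / 4.
  apply: le_trans hM; apply: le_trans (fnorm_sum _ _) _ => [l _|].
    by case: (rescaled_norm (lam l n) transY scalY (Sphi l)).
  apply: ler_sum => l _.
  by case: (rescaled_norm (lam l n) transY scalY (Sphi l)) => _ ->.
have h4 : fnorm Y T4 <= eps / 4 by exact: hN1.
apply: le_trans (fnormD _ _) _; [exact: in_spaceD..|].
have := fnormD T1Y T2Y; have := fnormD T3Y T4Y.
by move: h1 h2 h3 h4; lra.
Qed.

End Profiles.

(** * Extraction and asymptotic orthogonality *)

Section LimnEsup.
Variables (R : realType) (f : nat -> R).
Hypothesis f_ge0 : forall n, 0 <= f n.

Lemma limn_esup_ge0 : (0 <= limn_esup (fun n => (f n)%:E))%E.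
Proof.
apply/ereal_infP => _ [V /= VF <-]; have [n Vn] := filter_ex VF.
apply: le_trans (_ : (f n)%:E <= _)%E; first by rewrite lee_fin.
by apply: ereal_sup_ubound; exists n.
Qed.

Lemma limn_esup_le eps : (\forall n \near \oo, f n <= eps) ->
  (limn_esup (fun n => (f n)%:E) <= eps%:E)%E.
Proof.
move=> fe; apply: le_trans (ereal_inf_lbound _) _; first by exists [set n | f n <= eps].
by apply: ge_ereal_sup => _ [n /= fn <-]; rewrite lee_fin.
Qed.

End LimnEsup.

Lemma cvge0_nonneg (R : realType) (s : nat -> \bar R) :
    (forall L, 0 <= s L)%E ->
    (forall eps : R, 0 < eps -> \forall L \near \oo, (s L <= eps%:E)%E) ->
  s @ \oo --> 0%E.
Proof.
move=> s0 se; apply/fine_cvgP; split.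
  have [N _ hN] := se 1 ltr01; exists N => // L /hN /= h.
  by rewrite ge0_fin_numE // (le_lt_trans h) // ltry.
apply/cvgr0Pnorm_le => eps eps0; have [N _ hN] := se _ eps0.
exists N => // L /hN /= h; rewrite ger0_norm ?fine_ge0 // -lee_fin fineK //.
by rewrite ge0_fin_numE // (le_lt_trans h) // ltry.
Qed.

Lemma cvg_pinfty_nat (R : realType) (f : nat -> R) :
  (forall K : nat, \forall n \near \oo, K%:R <= f n) -> f @ \oo --> +oo.
Proof.
move=> fK; apply/cvgryPge => A.
have [N _ hN] := fK (Num.bound `|A|); exists N => // n /hN /= h.
apply: le_trans (ler_norm A) (le_trans _ h).
by rewrite ltW // archi_boundP.
Qed.

Section Approximation.
Variables (R : realType) (cplx : bool) (d : nat) (r : R).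
Variables (X Y : functionSpace R cplx d).
Variables (E : finType) (psi : E -> func R cplx d).
Hypothesis basisX : unconditional_basis r psi X.

Lemma wavelet_coefsE c f : wavelet_series r psi X c f ->
  wavelet_coefs r psi X f = c.
Proof.
move=> cf; have [_ uniqX _] := basisX.
have [c' [_ c'P]] := uniqX f (wavelet_series_in cf).
have h : [set c0 | wavelet_series r psi X c0 f] (wavelet_coefs r psi X f).
  by rewrite /wavelet_coefs; apply: xgetPex; exists c.
by rewrite -(c'P _ cf) (c'P _ h).
Qed.

(** The nonlinear approximation is only assumed on the unit ball, and ties may be
resolved differently for [f] and its multiples: for [f] in the ball of radius B,
the wavelets kept are those selected for [B^-1 f]. *)
Lemma uniform_approximation (sel : nat -> func R cplx d -> {fset nabla d}) B
    (u : nat -> func R cplx d) (c : nat -> coefs R cplx d E) :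
    continuous_embedding X Y -> unconditional_basis r psi Y ->
    selects_largest r psi X sel ->
    uniform_nonlinear_approximation r psi X Y sel ->
    0 < B -> (forall n, fnorm X (u n) <= B) ->
    (forall n, wavelet_series r psi X (c n) (u n)) ->
  exists2 F : nat -> nat -> {fset nabla d},
    forall n M, (0 < M)%N -> #|` F n M| = M &
    forall eps, 0 < eps -> exists M0, forall M n, (M0 <= M)%N ->
      fnorm Y (fun x => u n x - wavelet_sum r psi (c n) (F n M) x) <= eps.
Proof.
move=> embXY basisY selP approx B0 uB cu.
have [psiX _ _] := basisX; have [psiY _ _] := basisY.
pose b : Defs.scalar R cplx := of_real B^-1.
have mb : modulus b = B^-1 by rewrite modulus_real gtr0_norm // invr_gt0.
pose w n : func R cplx d := fun x => b * u n x.
have cw n : wavelet_series r psi X (fun l e => b * c n l e) (w n).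
  exact: (wavelet_seriesZ psiX b (cu n)).
have wX n : X (w n) by exact: wavelet_series_in (cw n).
exists (fun n M => sel M (w n)) => [n M M0|eps eps0].
  by have [] := selP M (w n) M0 (wX n).
have [[N1 _ hN1] /cvgr0Pnorm_le/(_ (eps / B) (divr_gt0 eps0 B0)) [N2 _ hN2]] :=
  (fine_cvgP _ _).1 approx.
exists (maxn N1 N2) => M n; rewrite geq_max => /andP[/hN1 h1 /hN2 h2].
have w1 : fnorm X (w n) <= 1.
  rewrite /w fnormZ ?mb; last exact: wavelet_series_in (cu n).
  by rewrite mulrC ler_pdivrMr // mul1r.
have h3 : fnorm Y (fun x => w n x - nonlinear_projector r psi X sel M (w n) x) <= eps / B.
  pose s := ereal_sup [set (fnorm Y (fun x =>
    f x - nonlinear_projector r psi X sel M f x))%:E | f in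
    [set f | X f /\ fnorm X f <= 1]].
  have s_fin : s \is a fin_num := h1.
  have s_le : `|fine s| <= eps / B := h2.
  apply: le_trans (le_trans (ler_norm _) s_le); rewrite -lee_fin fineK //.
  by apply: ereal_sup_ubound; exists (w n).
rewrite /nonlinear_projector (wavelet_coefsE (cw n)) in h3.
have -> : (fun x => u n x - wavelet_sum r psi (c n) (sel M (w n)) x) =
  (fun x => of_real B * (w n x -
     wavelet_sum r psi (fun l e => b * c n l e) (sel M (w n)) x)).
  apply/funext => x; rewrite wavelet_sumZ -mulrBr mulrA -of_realM.
  by rewrite divff ?gt_eqF // of_real1 mul1r.
rewrite fnormZ; last first.
  apply: in_spaceB; last exact: in_wavelet_sum.
  by apply: embXY.1.
by rewrite modulus_real gtr0_norm // mulrC -ler_pdivlMr.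
Qed.

End Approximation.

(** Ranks are in the same class when their relative position is constant along
the ultrafilter, and [p m] is the least member of the class of m. Two least
members are in different classes, hence diverge from each other by
[relpos_dichotomy]. *)
Lemma extraction (R : realType) (cplx : bool) (d : nat) (E : finType)
    (en : nat -> nat -> nabla d) (z : nat -> nat -> E -> Defs.scalar R cplx)
    (B : R) : (forall n m e, modulus (z n m e) <= B) ->
  exists (sigma : nat -> nat) (a : nat -> E -> Defs.scalar R cplx)
    (p : nat -> nat) (q : nat -> int * 'rV[R]_d),
  [/\ forall m n, (m < n)%N -> (sigma m < sigma n)%N,
      forall m e, (fun n => modulus (z (sigma n) m e - a m e)) @ \oo --> (0 : R),
      forall m, (p m <= m)%N /\ p (p m) = p m,
      forall m, \forall n \near \oo,
        relpos R (en (sigma n) m) (en (sigma n) (p m)) = q m &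
      forall k l, p k = k -> p l = l -> k != l ->
        (forall K : nat, \forall n \near \oo, K%:R <=
          `|scale_index (en (sigma n) k) - scale_index (en (sigma n) l)|%:~R :> R) \/
        (forall K : nat, \forall n \near \oo, K%:R <=
          enorm (relpos R (en (sigma n) k) (en (sigma n) l)).2)].
Proof.
move=> zB; have [U UU Uoo] := ultrafilter_oo.
have [a aP] : exists a : nat * E -> Defs.scalar R cplx, forall me eps, 0 < eps ->
    U [set n | modulus (z n me.1 me.2 - a me) < eps].
  have ex (me : nat * E) := ultra_cvg_scalar UU (fun n => zB n me.1 me.2).
  by have [a aP] := boolp.choice ex; exists a.
pose same m l := exists p, U [set n | relpos R (en n m) (en n l) = p].
have same_refl m : same m m.
  by exists (0, 0); apply: filterS filterT => n _; rewrite /= relpos_self.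
have same_sym m l : same m l -> same l m.
  move=> [p Up]; exists (- p.1, - ((2 : R) ^ (- p.1) *: p.2)).
  by apply: filterS Up => n /= <-; exact: relpos_sym.
have same_trans m l k : same m l -> same l k -> same m k.
  move=> [p Up] [p' Up']; exists (p.1 + p'.1, p.2 + (2 : R) ^ p.1 *: p'.2).
  by apply: filterS (filterI Up Up') => n /= [<- <-]; exact: relpos_trans.
have exm m : exists l, `[< same m l >] by exists m; exact/asboolP.
pose p m := ex_minn (exm m).
have pP m : [/\ same m (p m), (p m <= m)%N & forall l, same m l -> (p m <= l)%N].
  rewrite /p; case: ex_minnP => l /asboolP ml lmin; split=> // [|k mk].
    by apply: lmin; exact/asboolP.
  by apply: lmin; exact/asboolP.
have p_idem m : p (p m) = p m.
  have [m1 _ m3] := pP m; have [k1 k2 _] := pP (p m).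
  by apply/eqP; rewrite eqn_leq k2 m3 //; exact: same_trans k1.
have [q qP] : exists q : nat -> int * 'rV[R]_d, forall m,
    U [set n | relpos R (en n m) (en n (p m)) = q m].
  have ex m : exists p', U [set n | relpos R (en n m) (en n (p m)) = p'].
    by have [] := pP m.
  by have [q qP] := boolp.choice ex; exists q.
pose far1 (kl : nat * nat) (K : nat) := [set n | K%:R <=
  `|scale_index (en n kl.1) - scale_index (en n kl.2)|%:~R :> R].
pose far2 (kl : nat * nat) (K : nat) :=
  [set n | K%:R <= enorm (relpos R (en n kl.1) (en n kl.2)).2].
have far kl : p kl.1 = kl.1 -> p kl.2 = kl.2 -> kl.1 != kl.2 ->
    (forall K, U (far1 kl K)) \/ (forall K, U (far2 kl K)).
  case: kl => k l /= pk pl kl.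
  have [kl_same|hf|hf] := relpos_dichotomy R (en^~ k) (en^~ l) UU.
  - have kl' : same k l by [].
    have [_ _ /(_ _ kl')] := pP k; have [_ _ /(_ _ (same_sym _ _ kl'))] := pP l.
    by rewrite pk pl => h1 h2; rewrite eqn_leq h1 h2 in kl.
  - by left.
  - by right.
pose event (i : (nat * E) * nat + nat + (nat * nat) * nat) : set nat :=
  match i with
  | inl (inl (me, K)) => [set n | modulus (z n me.1 me.2 - a me) < K.+1%:R^-1]
  | inl (inr m) => [set n | relpos R (en n m) (en n (p m)) = q m]
  | inr (kl, K) => [set n |
      [/\ p kl.1 = kl.1, p kl.2 = kl.2 & kl.1 != kl.2] ->
      if `[< forall K, U (far1 kl K) >] then far1 kl K n else far2 kl K n]
  end.
have Uevent i : U (event i).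
  case: i => [[[me K]|m]|[kl K]] /=.
  - by apply: aP; rewrite invr_gt0.
  - exact: qP.
  have [[h1 h2 h3]|h] := pselect [/\ p kl.1 = kl.1, p kl.2 = kl.2 & kl.1 != kl.2].
    case: asboolP => hf; first by apply: filterS (hf K) => n hn _.
    by have [/hf//|hf2] := far _ h1 h2 h3; apply: filterS (hf2 K) => n hn _.
  by apply: filterS filterT => n _ /h.
have UN N : U [set n | (N <= n)%N] by apply: Uoo; exists N.
have [sigma [sigma_incr ev]] := ultra_subsequence UU UN Uevent.
exists sigma, (fun m e => a (m, e)), p, q; split=> //.
- move=> m e; apply/cvgr0Pnorm_le => eps eps0.
  have [K Ke] : exists K : nat, K.+1%:R^-1 < eps.
    have [K _ /(_ K (leqnn K)) /= hK] := near_infty_natSinv_lt (PosNum eps0).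
    by exists K.
  have [N _ hN] := ev (inl (inl ((m, e), K))).
  exists N => // n /hN /= h; rewrite ger0_norm ?modulus_ge0 // ltW //.
  exact: lt_trans Ke.
- by move=> m; have [_ ? _] := pP m; split; [|exact: p_idem].
- by move=> m; exact: ev (inl (inr m)).
move=> k l pk pl kl.
have evK K := ev (inr ((k, l), K)).
have [hf|hf] := pselect (forall K, U (far1 (k, l) K)); [left|right] => K.
  have [N _ hN] := evK K; exists N => // n /hN /=.
  by case: asboolP => // _; apply.
have [N _ hN] := evK K; exists N => // n /hN /=.
by case: asboolP => // _; apply.
Qed.

Theorem theorem1p1 (R : realType) (cplx : bool) (d : nat) (d_gt0 : (0 < d)%N)
    (X Y : functionSpace R cplx d) (r : R)
    (embXY : continuous_embedding X Y)
    (transX : translation_invariant X) (transY : translation_invariant Y)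
    (scalX : scaling_invariant r X) (scalY : scaling_invariant r Y)
    (E : finType) (psi : E -> func R cplx d)
    (basisX : unconditional_basis r psi X)
    (basisY : unconditional_basis r psi Y)
    (sel : nat -> func R cplx d -> {fset nabla d})
    (selP : selects_largest r psi X sel)
    (assumption1 : uniform_nonlinear_approximation r psi X Y sel)
    (assumption2 : coefficientwise_limit_bound r psi X)
    (u : nat -> func R cplx d) (u_bounded : bounded_seq_in X u) :
  exists (sigma : nat -> nat) (phi : nat -> func R cplx d)
         (lambda : nat -> nat -> nabla d),
    [/\ forall m n, (m < n)%N -> (sigma m < sigma n)%N,
        forall l, X (phi l),
        (fun L : nat => limn_esup (fun n : nat =>
           (fnorm Y (fun x => u (sigma n) x -
              \sum_(l < L) rescaled r (phi l) (lambda l n) x))%:E))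
          @ \oo --> 0%E &
        forall k l : nat, k != l ->
          (fun n : nat =>
             `|scale_index (lambda k n) - scale_index (lambda l n)|%:~R : R)
            @ \oo --> +oo
          \/
          (fun n : nat =>
             enorm (space_index R (lambda k n) -
               (2 : R) ^ (scale_index (lambda k n) - scale_index (lambda l n))
                 *: space_index R (lambda l n)))
            @ \oo --> +oo].
Proof.
have [psiX exX _] := basisX; have [psiY _ _] := basisY.
have [uX [B0 uB0]] := u_bounded.
pose B := `|B0| + 1.
have B_gt0 : 0 < B by rewrite ltr_wpDl.
have uB n : fnorm X (u n) <= B.
  by apply: le_trans (uB0 n) (le_trans (ler_norm _) _); rewrite lerDl.
have [c cu] : {c : nat -> coefs R cplx d E &
    forall n, wavelet_series r psi X (c n) (u n)}.
  apply: (@boolp.choice _ _ (fun n c => wavelet_series r psi X c (u n))) => n.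
  by have [c [cu _]] := exX _ (uX n); exists c.
have [F cardF approxF] :=
  uniform_approximation basisX embXY basisY selP assumption1 B_gt0 uB cu.
have [en enP] : {en : nat -> nat -> nabla d & forall n, injective (en n) /\
    forall M l, (0 < M)%N -> l \in F n M -> exists2 m, (m < M ^ 2)%N & en n m = l}.
  apply: (@boolp.choice _ _ (fun n e => injective e /\ forall M l, (0 < M)%N ->
    l \in F n M -> exists2 m, (m < M ^ 2)%N & e m = l)) => n.
  by have [e e1 e2] := enumerate_fsets (cardF n); exists e.
have en_inj n : injective (en n) by case: (enP n).
have en_approx eps : 0 < eps -> exists K0, forall K n, (K0 <= K)%N ->
    fnorm Y (fun x => u n x -
      enum_sum r psi (en n) predT K (fun m => c n (en n m)) x) <= eps.
  move=> eps0; have [D D0 DP] := basis_comparison basisY.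
  have [M0 M0P] := approxF _ (divr_gt0 eps0 D0).
  exists (M0.+1 ^ 2)%N => K n K0K.
  have cY : wavelet_series r psi Y (c n) (u n) by exact: wavelet_series_embed (cu n).
  have FK l : l \in F n M0.+1 -> exists2 m, (m < K)%N & en n m = l.
    move=> /(proj2 (enP n) M0.+1 l isT) [m mM <-]; exists m => //.
    exact: leq_trans mM K0K.
  apply: le_trans (enum_approx_le (en_inj n) psiY DP cY FK) _.
  by rewrite mulrC -ler_pdivlMr // M0P.
have [K K0 KP] := basis_coef_bound transX scalX basisX.
have zB n m e : modulus (c n (en n m) e) <= K * B.
  by apply: le_trans (KP _ _ _ _ (cu n)) _; rewrite ler_pM2l.
have [sigma [a [p [q [sigma_incr a_lim pP q_pos far]]]]] :=
  extraction en (z := fun n m => c n (en n m)) zB.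
have p_le m : (p m <= m)%N by case: (pP m).
have p_idem m : p (p m) = p m by case: (pP m).
have en_approx' eps : 0 < eps -> exists K0, forall K n, (K0 <= K)%N ->
    fnorm Y (fun x => u (sigma n) x - enum_sum r psi (en (sigma n)) predT K
      (fun m => c (sigma n) (en (sigma n) m)) x) <= eps.
  by move=> /en_approx [K1 h]; exists K1 => K' n; exact: h.
have [phi phiX remainder] := profile_remainder embXY transX scalX transY scalY
  basisX basisY assumption2 (fun n => uB (sigma n)) (fun n => cu (sigma n))
  (fun n => @en_inj (sigma n)) en_approx' a_lim p_le p_idem q_pos.
(* To keep profiles indexed by all of nat, a rank that is not the least of its
   class, whose profile is an empty sum, is placed at a scale beyond those of the
   wavelets of rank at most n; the term m.+1 * n separates two such ranks. *)
pose J n := (\sum_(i < n.+1) `|scale_index (en (sigma n) i)|)%R.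
pose pad m n : nabla d := (J n + (m.+1 * n)%N%:Z, 0).
pose lam m n := if p m == m then en (sigma n) m else pad m n.
exists sigma, phi, lam; split=> //.
  have lamE l n : p l = l -> lam l n = en (sigma n) l by move=> pl; rewrite /lam pl eqxx.
  have rY L n : Y (fun x => u (sigma n) x -
      \sum_(l < L) rescaled r (phi l) (lam l n) x).
    apply: in_spaceB; first by apply: embXY.1.
    apply: in_space_sum => l _.
    by have [] := rescaled_norm (lam l n) transY scalY (embXY.1 _ (phiX l)).
  apply: cvge0_nonneg => [L|eps eps0].
    by apply: limn_esup_ge0 => n; exact: fnorm_ge0.
  have [L0 L0P] := remainder lam lamE eps eps0.
  by exists L0 => // L /= L0L; apply: limn_esup_le; exact: L0P.
move=> k l kl.
have J_ge m n : (m <= n)%N -> `|scale_index (en (sigma n) m)| <= J n.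
  move=> mn; have mn' : (m < n.+1)%N by [].
  by rewrite /J (bigD1 (Ordinal mn')) //= lerDl sumr_ge0.
have scale_far (f g : nat -> nabla d) :
    (\forall n \near \oo, n%:Z <= `|scale_index (f n) - scale_index (g n)|) ->
    (fun n : nat => `|scale_index (f n) - scale_index (g n)|%:~R : R) @ \oo --> +oo.
  move=> [N _ hN]; apply: cvg_pinfty_nat => K'; exists (maxn N K') => // n /=.
  rewrite geq_max => /andP[/hN /= h Kn].
  rewrite -[K'%:R]/((K'%:Z)%:~R) ler_int; apply: le_trans h.
  by rewrite lez_nat.
rewrite /lam; have [pk|pk] := eqVneq (p k) k; have [pl|pl] := eqVneq (p l) l.
- by have [h|h] := far _ _ pk pl kl; [left|right]; exact: cvg_pinfty_nat.
- left; apply: scale_far; exists k => // n /= kn.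
  by have := J_ge _ _ kn; rewrite /scale_index /=; lia.
- left; apply: scale_far; exists l => // n /= ln.
  by have := J_ge _ _ ln; rewrite /scale_index /=; lia.
left; apply: scale_far; exists 0%N => // n _.
rewrite /pad /scale_index /=.
have -> : J n + (k.+1 * n)%N%:Z - (J n + (l.+1 * n)%N%:Z) = (k%:Z - l%:Z) * n%:Z.
  by lia.
rewrite normrM (@ger0_norm _ n%:Z) // ler_peMl //.
by move: kl => /eqP kl; lia.
Qed.
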